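(* (i) Any $m\in\mathbb{N}$ can be written as $x^2+y^2+z^2+w^2$ with $x,y,z\in\mathbb{N}/3$ and $w\in\mathbb{N}$ such that $x+y+3z$ is an integer square. (ii) Any $m\in\mathbb{N}$ can be written as $x^2+y^2+z^2+w^2$ with $x,y,z,w\in\mathbb{N}/5$ such that $x+2y+3z$ is an integer square.
   Context: $\mathbb{N}=\{0,1,2,\ldots\}$; for a positive integer $q$, $\mathbb{N}/q=\{k/q: k\in\mathbb{N}\}$; an integer square is an element of $\{t^2: t\in\mathbb{Z}\}$. *)

(* Defs.v *)
From mathcomp Require Import all_boot all_order all_algebra.

Set Implicit Arguments.
Unset Strict Implicit.
Unset Printing Implicit Defensive.

Import GRing.Theory.
Local Open Scope ring_scope.

(* The set N/q = {k/q : k in N}, meaningful for q > 0. *)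
Definition natfrac (q : nat) (x : rat) : Prop :=
  exists k : nat, x = k%:R / q%:R.

Definition int_square (x : rat) : Prop := exists t : int, x = (t ^+ 2)%:~R.

(* Main.v *)
Require Import Defs.
From Stdlib Require Import ZArith Lia List.
From mathcomp Require Import all_boot all_order all_algebra all_solvable all_field.
From mathcomp Require Import zify ring.

Set Implicit Arguments.
Unset Strict Implicit.
Unset Printing Implicit Defensive.

Import Order.TTheory GRing.Theory Num.Theory.
Local Open Scope ring_scope.

(** After scaling by 16 it may be assumed that 16 does not divide m. In part (i),
    let t satisfy 8 m <= t^4 <= 11 m and let 11 m - t^4 = A^2 + B^2 + C^2. The
    quaternion t^2 + A i + B j + C k has norm 11 m, hence a divisor of norm 11,
    and every representation of 11 as a sum of four squares is a signed
    permutation of 9 + 1 + 1 + 0. After a signed permutation of A, B, C the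
    divisor is i + j + 3 k, and the quotient gives integers with x + y + 3 z = t^2
    and x^2 + y^2 + z^2 + w^2 = m [quaternion_quotient]. As t^4 is large compared
    with m, the point (x, y, z) is close to the axis (1, 1, 3), and a negative
    coordinate is repaired by a reflection with denominator 3 that fixes this axis
    [reflection_thirds]. Part (ii) uses 14 m - t^4, the quaternion i + 2 j + 3 k,
    the range 8 m <= t^4 <= 14 m, and isometries with denominator 5
    [reflection_fifths].

    The numbers t^4 in the given range, with t in a residue class modulo 2 or 4
    that makes 11 m - t^4 or 14 m - t^4 a sum of three squares, exist for all but
    finitely many m. For the remaining m, a search finds solutions [coverage].

    This leaves the theorem on sums of three squares [three_squares]. By Hermite
    reduction, an integral ternary form of determinant 1 is a sum of three squares
    [ternary_sum3], and n is a value of such a form if there is an N such that -N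
    is a square modulo n and -n is a square modulo N
    [three_squares_of_residues]. These conditions prescribe the quadratic
    characters of N modulo the primes of n and require all primes of N to split in
    the field of the square root of -n; by quadratic reciprocity they are
    compatible exactly when n is not 7 mod 8. Usually N is obtained from
    Dirichlet's theorem on primes. Here N need not be prime, and a counting
    argument suffices [genus_divisor_sum]. Let chi be the character of that field
    and R(N) the sum of chi over the divisors of N. For a genus character psi other
    than 1 and chi, the sum of R(N) psi(N) over N <= X is O(sqrt X) by the
    hyperbola method, whereas the values of u^2 + n v^2 show that the sum of R(N)
    exceeds every multiple of sqrt X. So every compatible choice of characters is
    taken by some N with R(N) nonzero, and the primes that do not split divide
    such an N to even powers. *)

(** * Quadratic characters and quadratic reciprocity *)

(** The quadratic character of a finite field of odd order. *)
Definition qchar (F : finFieldType) (x : F) : int :=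
  if x == 0 then 0 else if [exists y : F, y ^+ 2 == x] then 1 else -1.

Lemma intr_pchar_eq0 (K : nzRingType) (p : nat) (a : int) :
  p \in [pchar K] -> ((a%:~R : K) == 0) = (p %| a)%Z.
Proof.
move=> pK; have -> : ((a%:~R : K) == 0) = (`|a|%N%:R == 0 :> K).
  rewrite pmulrn; have [->|->] : `|a|%N = a :> int \/ `|a|%N = - a :> int by lia.
    by [].
  by rewrite intrN oppr_eq0.
by rewrite -(dvdn_pcharf pK).
Qed.

(** Identities between signs are established in fields of odd characteristic,
    where Euler's criterion and Gauss sums live, and are lifted to the integers
    by this injectivity. *)
Lemma intr_sign_inj (K : fieldType) (p : nat) (a b : int) :
  p \in [pchar K] -> odd p -> `|a| <= 1 -> `|b| <= 1 ->
  (a%:~R : K) = b%:~R -> a = b.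
Proof.
move=> pK p_odd a1 b1 eq_ab.
have: (p %| a - b)%Z by rewrite -(intr_pchar_eq0 _ pK) intrB eq_ab subrr.
have p_pr := pcharf_prime pK.
have p3 : (2 < p)%N by move: p_odd p_pr; clear; case: p => [|[|[|]]].
rewrite dvdzE; case: (posnP `|a - b|%N) => [|gt0 /(dvdn_leq gt0)] /=; lia.
Qed.

Lemma finField_primitive_root (F : finFieldType) :
  exists g : F, #|F|.-1.-primitive_root g.
Proof.
have F1 : (1 < #|F|)%N := finNzRing_gt1 F.
have /hasP[g _ gP] : has #|F|.-1.-primitive_root [seq x <- enum F | x != 0].
  apply: has_prim_root; first by lia.
  - apply/allP => x; rewrite mem_filter => /andP[x0 _].
    rewrite unity_rootE; apply/eqP/(mulfI x0).
    by rewrite mulr1 -exprS prednK ?expf_card // ltnW.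
  - by rewrite filter_uniq ?enum_uniq.
  - rewrite size_filter -sum1_count big_enum_cond /= sum1_card.
    rewrite (eq_card (B := predC1 (0 : F))); last by move=> x; rewrite !inE.
    by rewrite cardC1.
by exists g.
Qed.

Section PrimeField.
Variable p : nat.
Hypotheses (p_pr : prime p) (p_odd : odd p).
Local Notation F := 'F_p.

Lemma qchar_norm (x : F) : `|qchar x| <= 1.
Proof. by rewrite /qchar; case: ifP => // _; case: ifP. Qed.

Lemma qchar_sqr1 (x : F) : x != 0 -> qchar x ^+ 2 = 1.
Proof. by rewrite /qchar => /negPf->; case: ifP. Qed.

Lemma fermat_Fp (x : F) : x != 0 -> x ^+ p.-1 = 1.
Proof.
move=> x0; apply: (mulfI x0); rewrite mulr1 -exprS prednK ?prime_gt0 //.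
by have := expf_card x; rewrite card_Fp.
Qed.

Lemma primitive_unit : exists g : F, p.-1.-primitive_root g.
Proof. by have := finField_primitive_root 'F_p; rewrite card_Fp. Qed.

Lemma half_pred : p.-1 = (p.-1./2 * 2)%N.
Proof. by have := prime_gt0 p_pr; lia. Qed.

Lemma primitive_half_pow (g : F) : p.-1.-primitive_root g -> g ^+ p.-1./2 = -1.
Proof.
move=> gP; have: (g ^+ p.-1./2) ^+ 2 == 1.
  by rewrite -exprM -half_pred prim_expr_order.
rewrite sqrf_eq1 => /orP[/eqP|/eqP//].
move/eqP; rewrite -(prim_order_dvd gP) => /dvdn_leq.
by have := prime_gt1 p_pr; have := half_pred; lia.
Qed.

(** Fermat's little theorem makes x^((p-1)/2) a square root of 1; the parity of
    the exponent of x as a power of a generator tells which one. *)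
Lemma euler_criterion (x : F) : (qchar x)%:~R = x ^+ p.-1./2.
Proof.
have p1 := prime_gt1 p_pr; have hp := half_pred.
have [->|x0] := eqVneq x 0; first by rewrite /qchar eqxx expr0n; case: eqP => //; lia.
rewrite /qchar (negPf x0); have [g gP] := primitive_unit.
case: existsP => [[y /eqP yx]|nsq].
  rewrite -yx -exprM mulnC -hp fermat_Fp //.
  by apply: contra_neq x0 => y0; rewrite -yx y0 expr0n.
have [i xE] := prim_rootP gP (fermat_Fp x0).
have iodd : odd i.
  apply/negPn/negP => iev; case: nsq; exists (g ^+ i./2).
  by rewrite -exprM xE; apply/eqP; congr (_ ^+ _); lia.
rewrite xE -exprM mulnC exprM (primitive_half_pow gP) -signr_odd iodd expr1.
by rewrite rmorphN.
Qed.

Lemma qcharM (x y : F) : qchar (x * y) = qchar x * qchar y.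
Proof.
apply: (intr_sign_inj (pchar_Fp p_pr) p_odd); rewrite ?qchar_norm //.
  by rewrite normrM mulr_ile1 ?normr_ge0 ?qchar_norm.
by rewrite rmorphM /= !euler_criterion exprMn.
Qed.

Lemma qchar1 : qchar (1 : F) = 1.
Proof.
rewrite /qchar oner_eq0; case: existsP => // -[]; exists 1.
by rewrite expr1n.
Qed.

Lemma qchar_nonresidue : exists2 g : F, g != 0 & qchar g = -1.
Proof.
have [g gP] := primitive_unit.
have qg : qchar g = -1.
  apply: (intr_sign_inj (pchar_Fp p_pr) p_odd); rewrite ?qchar_norm //.
  by rewrite euler_criterion primitive_half_pow // rmorphN.
by exists g => //; apply/eqP => g0; move: qg; rewrite g0 /qchar eqxx.
Qed.

Lemma sum_qchar : \sum_(x : F) qchar x = 0.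
Proof.
have [g g0 qg] := qchar_nonresidue.
have: \sum_(x : F) qchar x = - \sum_(x : F) qchar x.
  rewrite {1}(reindex_onto (fun x => g * x) (fun x => g^-1 * x)) /=; last first.
    by move=> x _; rewrite mulVKf.
  rewrite -sumrN; apply: eq_big => x; first by rewrite mulKf ?eqxx.
  by rewrite qcharM qg mulN1r.
lia.
Qed.
End PrimeField.

(** q divides p^totient(q) - 1, so the field with p^totient(q) elements will do. *)
Lemma prim_root_exists_pchar (p q : nat) : prime p -> (0 < q)%N -> coprime q p ->
  exists (K : fieldType) (z : K), p \in [pchar K] /\ q.-primitive_root z.
Proof.
move=> p_pr q0 cqp.
have [K pK cardK] := pPrimePowerField p_pr (k := totient q) (ltac:(by rewrite totient_gt0)).
have [g] := finField_primitive_root K; rewrite cardK => gP.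
exists K, (g ^+ ((p ^ totient q).-1 %/ q)); split=> //.
apply: dvdn_prim_root => //.
rewrite -subn1 -eqn_mod_dvd ?expn_gt0 ?prime_gt0 //.
by rewrite Euler_exp_totient // coprime_sym.
Qed.

Definition leg (p : nat) (a : int) : int := qchar (a%:~R : 'F_p).

Section Legendre.
Variable p : nat.
Hypotheses (p_pr : prime p) (p_odd : odd p).

Lemma intr_Fp_eq0 (a : int) : ((a%:~R : 'F_p) == 0) = (p %| a)%Z.
Proof. exact: intr_pchar_eq0 (pchar_Fp p_pr). Qed.

Lemma legM (a b : int) : leg p (a * b) = leg p a * leg p b.
Proof. by rewrite /leg intrM qcharM. Qed.

Lemma leg_mod (a b : int) : (p %| a - b)%Z -> leg p a = leg p b.
Proof.
by rewrite -intr_Fp_eq0 intrB subr_eq0 /leg => /eqP->.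
Qed.

Lemma leg_sqr1 (a : int) : ~~ (p %| a)%Z -> leg p a ^+ 2 = 1.
Proof. by move=> a0; rewrite /leg qchar_sqr1 // intr_Fp_eq0. Qed.

Lemma leg1 : leg p 1 = 1.
Proof. exact: qchar1. Qed.

Lemma leg_square (b : int) : ~~ (p %| b)%Z -> leg p (b ^+ 2) = 1.
Proof. by move=> b0; rewrite expr2 legM -expr2 leg_sqr1. Qed.

Lemma leg1_square (a : int) : leg p a = 1 -> exists b : int, (p %| b ^+ 2 - a)%Z.
Proof.
rewrite /leg /qchar; case: ifP => // _; case: existsP => // -[y /eqP ya] _.
exists (val y : nat)%:Z; rewrite -intr_Fp_eq0 intrB [_ ^+ 2]expr2 intrM -expr2 -pmulrn.
have -> : (val y)%:R = y by exact: natr_Zp.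
by rewrite ya subrr.
Qed.

Lemma leg_norm (a : int) : `|leg p a| <= 1.
Proof. exact: qchar_norm. Qed.
End Legendre.

Section GaussSum.
Variables (p q : nat) (K : fieldType) (z : K).
Hypotheses (q_pr : prime q) (q_odd : odd q) (zP : q.-primitive_root z).
Local Notation Fq := 'F_q.

Let zz (x : Fq) : K := z ^+ (val x : nat).

Lemma val_FqD (x y : Fq) : val (x + y) = ((val x + val y) %% q)%N.
Proof. by rewrite /= [X in (_ %% X)%N]Fp_cast. Qed.

Lemma val_FqM (x y : Fq) : val (x * y) = ((val x * val y) %% q)%N.
Proof. by rewrite /= [X in (_ %% X)%N]Fp_cast. Qed.

Let zzD (x y : Fq) : zz (x + y) = zz x * zz y.
Proof. by rewrite /zz val_FqD (prim_expr_mod zP) exprD. Qed.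

Let zzM (n : nat) (x : Fq) : zz (n%:R * x) = zz x ^+ n.
Proof.
have e : val (n%:R : Fq) = (n %% q)%N := val_Fp_nat q_pr n.
rewrite /zz val_FqM e modnMml (prim_expr_mod zP) -exprM.
by rewrite mulnC.
Qed.

Let sum_zz : \sum_(x : Fq) zz x = 0.
Proof.
have z1 : zz 1 != 1.
  rewrite /zz -(prim_order_dvd zP).
  have -> : val (1 : Fq) = 1%N by rewrite /= [X in (_ %% X)%N]Fp_cast // modn_small // prime_gt1.
  by rewrite dvdn1; have := prime_gt1 q_pr; lia.
apply: (mulfI (_ : zz 1 - 1 != 0)); first by rewrite subr_eq0.
rewrite mulr0 mulrBl mul1r mulr_sumr.
rewrite [X in _ - X](reindex_onto (fun x => 1 + x) (fun x => x - 1)) /=; last first.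
  by move=> x _; rewrite addrCA subrr addr0.
apply/eqP; rewrite subr_eq0; apply/eqP; apply: eq_big => x.
  by rewrite [1 + x]addrC addrK eqxx.
by rewrite zzD.
Qed.

Let tau : K := \sum_(x : Fq) (qchar x)%:~R * zz x.

(** The substitution y = x c turns the double sum into the sums over x of
    z^(x (1 + c)), which are constant except for c = -1. *)
Lemma gauss_sum_sqr : tau ^+ 2 = (leg q (-1) * q%:Z)%:~R.
Proof.
have zz0 : zz 0 = 1 by rewrite /zz expr0.
have inner (c : Fq) : \sum_(x : Fq | x != 0) zz (x * (1 + c)) =
    if c == -1 then q%:R - 1 else -1.
  have [->|c1] := eqVneq.
    rewrite (eq_bigr (fun=> 1)); last by move=> x _; rewrite subrr mulr0 zz0.
    rewrite sumr_const; have -> : #|[pred x : Fq | x != 0]| = q.-1.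
      rewrite (eq_card (B := predC1 (0 : Fq))); last by move=> x; rewrite !inE.
      by rewrite cardC1 card_Fp.
    by rewrite -subn1 natrB // prime_gt0.
  have c0 : 1 + c != 0 by rewrite addrC addr_eq0.
  have : \sum_(x : Fq) zz (x * (1 + c)) = 0.
    rewrite -[RHS]sum_zz [RHS](reindex_onto (fun x => x * (1 + c))
      (fun x => x / (1 + c))) /=; last by move=> x _; rewrite mulfVK.
    by apply: eq_bigl => x; rewrite mulfK ?eqxx.
  rewrite (bigD1 0) //= mul0r zz0 => /eqP.
  by rewrite addrC addr_eq0 => /eqP.
rewrite expr2 mulr_suml (bigD1 0) //= /qchar eqxx mul0r mul0r add0r -/qchar.
transitivity (\sum_(x : Fq | x != 0) \sum_(c : Fq) (qchar c)%:~R * zz (x * (1 + c)) : K).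
  apply: eq_bigr => x x0; rewrite mulr_sumr.
  rewrite (reindex_onto (fun y => x * y) (fun y => x^-1 * y)) /=; last first.
    by move=> y _; rewrite mulVKf.
  apply: eq_big => y; first by rewrite mulKf ?eqxx.
  move=> _; rewrite mulrDr mulr1 zzD mulrACA -intrM qcharM //.
  by rewrite [X in X%:~R]mulrA -expr2 qchar_sqr1 // mul1r.
rewrite exchange_big /=.
rewrite (eq_bigr (fun c : Fq => (qchar c)%:~R * (if c == -1 then q%:R - 1 else -1))); last first.
  by move=> c _; rewrite -mulr_sumr inner.
rewrite (bigD1 (-1)) //= eqxx (eq_bigr (fun c : Fq => - (qchar c)%:~R)); last first.
  by move=> c /negPf->; rewrite mulrN1.
rewrite sumrN; have := sum_qchar q_pr q_odd; rewrite (bigD1 (-1)) //=.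
move=> /(congr1 (fun n : int => n%:~R : K)); rewrite intrD rmorph_sum /= => /eqP.
rewrite addr_eq0 /leg intrN mulr1z => /eqP h.
by rewrite -[\sum_(i | _) _]opprK -h intrM -pmulrn; ring.
Qed.

Hypotheses (p_pr : prime p) (p_odd : odd p) (pK : p \in [pchar K]) (neq_pq : p != q).

(** Frobenius fixes the signs and permutes the roots of unity by x |-> p x. *)
Lemma gauss_sum_frobenius : tau ^+ p = (leg q p)%:~R * tau.
Proof.
have p0 : (p%:R : Fq) != 0.
  by rewrite -(dvdn_pcharf (pchar_Fp q_pr)) dvdn_prime2 // eq_sym.
rewrite /tau -(pFrobenius_autE pK) rmorph_sum /=.
rewrite mulr_sumr [RHS](reindex_onto (fun x => p%:R * x) (fun x => p%:R^-1 * x)) /=; last first.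
  by move=> x _; rewrite mulVKf.
apply: eq_big => x; first by rewrite mulKf ?eqxx.
move=> _; rewrite rmorphM /= rmorph_int zzM pFrobenius_autE mulrA -intrM.
by rewrite qcharM // mulrA /leg -pmulrn -expr2 qchar_sqr1 // mul1r.
Qed.

(** The power tau^(p-1) is computed by Euler's criterion from the value of
    tau^2, and by Frobenius from the permutation of the roots of unity. *)
Lemma gauss_reciprocity : leg p (leg q (-1) * q%:Z) = leg q p.
Proof.
have hp := half_pred p_pr p_odd; have p1 := prime_gt1 p_pr.
set qs := leg q (-1) * _.
have qs1 : `|leg q (-1)| = 1.
  have : leg q (-1) ^+ 2 = 1.
    by rewrite leg_sqr1 // dvdzE /= dvdn1; have := prime_gt1 q_pr; lia.
  by move/eqP; rewrite sqrf_eq1 => /orP[] /eqP->.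
have qsK : (qs%:~R : K) != 0.
  rewrite /qs intrM mulf_neq0 //.
    move: qs1; case: (leg q (-1)) => [[|[|n]]|[|n]] // _.
      by rewrite oner_neq0.
    by rewrite oppr_eq0 oner_neq0.
  by rewrite -pmulrn -(dvdn_pcharf pK) dvdn_prime2.
have tau0 : tau != 0.
  by apply: contra_neq qsK => tau0; rewrite /qs -gauss_sum_sqr tau0 expr0n.
apply: (intr_sign_inj pK p_odd); rewrite ?leg_norm //.
apply: (mulIf tau0); rewrite -gauss_sum_frobenius.
rewrite -[in RHS](prednK (prime_gt0 p_pr)) exprSr; congr (_ * _).
rewrite hp mulnC exprM gauss_sum_sqr.
have /eqP : (leg p qs)%:~R = (qs%:~R : 'F_p) ^+ p.-1./2 by apply: euler_criterion.
rewrite -rmorphXn /= -subr_eq0 -rmorphB /= (intr_pchar_eq0 _ (pchar_Fp p_pr)).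
rewrite -(intr_pchar_eq0 _ pK) rmorphB rmorphXn subr_eq0.
by rewrite eq_sym => /eqP.
Qed.
End GaussSum.

(** The Dirichlet characters with chi4 p = (-1/p) and chi8 p = (2/p). *)
Definition chi4 (n : nat) : int := if odd n then if (n %% 4 == 1)%N then 1 else -1 else 0.
Definition chi8 (n : nat) : int :=
  if odd n then if (n %% 8 == 1)%N || (n %% 8 == 7)%N then 1 else -1 else 0.

Lemma leg_minus1 (p : nat) : prime p -> odd p -> leg p (-1) = chi4 p.
Proof.
move=> p_pr p_odd; have hp := half_pred p_pr p_odd; have p0 := prime_gt0 p_pr.
apply: (intr_sign_inj (pchar_Fp p_pr) p_odd); rewrite ?leg_norm //.
  by rewrite /chi4 p_odd; case: ifP.
rewrite /leg intrN mulr1z euler_criterion // -signr_odd /chi4 p_odd.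
by case: (boolP (odd _)) => h; [rewrite ifF | rewrite ifT]; rewrite ?expr1 ?intrN //; lia.
Qed.

(** The sum of a primitive 8th root of unity and its inverse is a square root
    of 2 on which Frobenius acts by a sign depending on p mod 8. *)
Lemma leg_two (p : nat) : prime p -> odd p -> leg p 2 = chi8 p.
Proof.
move=> p_pr p_odd; have hp := half_pred p_pr p_odd; have p0 := prime_gt0 p_pr.
have [K [z [pK zP]]] : exists (K : fieldType) (z : K), p \in [pchar K] /\ 8.-primitive_root z.
  by apply: prim_root_exists_pchar => //; have := @coprime_pexpl 3 2 p isT; rewrite coprime2n p_odd.
have z8 : z ^+ 8 = 1 := prim_expr_order zP.
have z4 : z ^+ 4 = -1.
  have : (z ^+ 4) ^+ 2 == 1 by rewrite -exprM z8.
  by rewrite sqrf_eq1 -(prim_order_dvd zP) => /orP[|/eqP].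
pose tau := z + z ^+ 7.
have tau2 : tau ^+ 2 = 2%:R.
  have -> : tau ^+ 2 = 2%:R * z ^+ 8 + z ^+ 2 * (1 + z ^+ 4 * z ^+ 8) by rewrite /tau; ring.
  by rewrite z8 z4; ring.
have two0 : (2%:R : K) != 0.
  by rewrite -(dvdn_pcharf pK) dvdn_prime2 //; lia.
have tau0 : tau != 0.
  by apply: contra_neq two0 => t0; rewrite -tau2 t0 expr0n.
have frob : tau ^+ p = (chi8 p)%:~R * tau.
  rewrite /tau -(pFrobenius_autE pK) rmorphD rmorphXn /= !pFrobenius_autE -exprM.
  have -> : z ^+ p = z ^+ (p %% 8) by rewrite (prim_expr_mod zP).
  have -> : z ^+ (p * 7) = z ^+ ((p %% 8 * 7) %% 8).
    by rewrite (prim_expr_mod zP) !exprM (prim_expr_mod zP).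
  rewrite /chi8 p_odd.
  have : [\/ p %% 8 = 1, p %% 8 = 3, p %% 8 = 5 | p %% 8 = 7]%N.
    have : (p %% 8 < 8)%N by rewrite ltn_mod.
    have : odd (p %% 8) by lia.
    by case: (p %% 8)%N => [|[|[|[|[|[|[|[|n]]]]]]]] // _ _; constructor.
  have z5 : z ^+ 5 = - z by rewrite exprS z4 mulrN1.
  have z73 : z ^+ 7 = - z ^+ 3 by rewrite (exprD z 4 3) z4 mulN1r.
  by case=> ->; rewrite /= ?expr1 ?z5 ?z73; ring.
apply: (intr_sign_inj pK p_odd); rewrite ?leg_norm //.
  by rewrite /chi8 p_odd; case: ifP.
apply: (mulIf tau0); rewrite -frob -[in RHS](prednK p0) exprSr; congr (_ * _).
rewrite hp mulnC exprM tau2.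
have /eqP : (leg p 2)%:~R = (2%:~R : 'F_p) ^+ p.-1./2 by apply: euler_criterion.
rewrite -rmorphXn /= -subr_eq0 -rmorphB /= (intr_pchar_eq0 _ (pchar_Fp p_pr)).
by rewrite -(intr_pchar_eq0 _ pK) rmorphB rmorphXn subr_eq0 => /eqP.
Qed.

Theorem quadratic_reciprocity (p q : nat) : prime p -> odd p -> prime q -> odd q ->
  p != q -> leg p (chi4 q * q%:Z) = leg q p.
Proof.
move=> p_pr p_odd q_pr q_odd neq.
have [K [z [pK zP]]] := prim_root_exists_pchar p_pr (prime_gt0 q_pr)
  (ltac:(by rewrite prime_coprime // dvdn_prime2 // eq_sym)).
by rewrite -leg_minus1 //; apply: gauss_reciprocity zP _ _ pK neq.
Qed.

(** * Sums of periodic functions and of divisor functions *)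

Lemma norm_sum_nat_le (f : nat -> int) (a b : nat) (B : int) :
  (forall i, `|f i| <= B) -> `|\sum_(a <= i < b) f i| <= (b - a)%N%:Z * B.
Proof.
move=> fB; apply: le_trans (ler_norm_sum _ _ _) _.
apply: le_trans (ler_sum_nat (G := fun=> B) _) _; first by move=> i _; exact: fB.
by rewrite sumr_const_nat -mulr_natl natz.
Qed.

(** Full periods contribute nothing, so fewer than M terms remain. *)
Lemma periodic_sum_bound (f : nat -> int) (M : nat) :
  (0 < M)%N -> (forall a, f (a + M)%N = f a) -> (forall a, `|f a| <= 1) ->
  \sum_(0 <= i < M) f i = 0 -> forall a b, `|\sum_(a <= i < b) f i| <= M%:Z.
Proof.
move=> M0 fM f1 sum0.
have shift a : \sum_(a <= i < a + M) f i = 0.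
  elim: a => [//|a IHa]; have := IHa.
  by rewrite big_ltn ?addSn ?big_nat_recr /= ?fM; [rewrite addrC|lia..].
move=> a b; move: {2}(b - a)%N.+1 (ltnSn (b - a)) => k.
elim: k a b => // k IHk a b ltk; have [le|gt] := leqP (b - a) M.
  apply: le_trans (norm_sum_nat_le a b f1) _; lia.
rewrite (big_cat_nat (n := (a + M)%N)) /= ?shift ?add0r; [|lia..].
by apply: IHk; lia.
Qed.

Lemma sum_dvd (g : nat -> int) (X d : nat) : (0 < d)%N ->
  \sum_(1 <= N < X.+1 | (d %| N)%N) g (N %/ d)%N = \sum_(1 <= e < (X %/ d).+1) g e.
Proof.
move=> d0; elim: X => [|X IHX]; first by rewrite div0n !big_geq.
rewrite big_mkcond big_nat_recr //= -big_mkcond IHX divnS //.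
case: (d %| X.+1)%N => /=; last by rewrite addr0 add0n.
by rewrite add1n [RHS]big_nat_recr.
Qed.

(** Dirichlet's hyperbola method: one of the two factors of a pair d e <= X is
    at most the square root of X, and the sum over the other one is bounded. *)
Lemma hyperbola_bound (f g : nat -> int) (B X s : nat) :
  (forall i, `|f i| <= 1) -> (forall i, `|g i| <= 1) ->
  (forall a b, `|\sum_(a <= i < b) f i| <= B%:Z) ->
  (forall a b, `|\sum_(a <= i < b) g i| <= B%:Z) ->
  (s <= X)%N -> (X < s.+1 ^ 2)%N ->
  `|\sum_(1 <= N < X.+1) \sum_(1 <= d < X.+1 | (d %| N)%N) f d * g (N %/ d)%N|
     <= (2 * s * B)%N%:Z.
Proof.
move=> f1 g1 fB gB sX Xs.
have -> : \sum_(1 <= N < X.+1) \sum_(1 <= d < X.+1 | (d %| N)%N) f d * g (N %/ d)%N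
   = \sum_(1 <= d < X.+1) f d * \sum_(1 <= e < (X %/ d).+1) g e.
  under eq_bigr do rewrite big_mkcond /=.
  rewrite exchange_big_nat /=; apply: eq_big_nat => d /andP[d0 _].
  by rewrite -big_mkcond -mulr_sumr sum_dvd.
rewrite (big_cat_nat (n := s.+1)) //=.
have -> : \sum_(s.+1 <= d < X.+1) f d * \sum_(1 <= e < (X %/ d).+1) g e
   = \sum_(1 <= e < s.+1) g e * \sum_(s.+1 <= d < (X %/ e).+1) f d.
  transitivity (\sum_(s.+1 <= d < X.+1) \sum_(1 <= e < s.+1 | (d * e <= X)%N) f d * g e).
    apply: eq_big_nat => d /andP[sd dX]; rewrite mulr_sumr.
    have le : (X %/ d <= s)%N by rewrite -ltnS ltn_divLR; nia.
    rewrite (big_nat_widen _ _ s.+1) //=; apply: eq_bigl => e.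
    by rewrite ltnS leq_divRL 1?mulnC //; lia.
  under eq_bigr do rewrite big_mkcond /=.
  rewrite exchange_big_nat /=; apply: eq_big_nat => e /andP[e0 es].
  rewrite -big_mkcond mulr_sumr [RHS](big_nat_widen _ _ X.+1) /=; last first.
    by have := leq_div X e; lia.
  apply: eq_big => d; first by rewrite ltnS leq_divRL.
  by rewrite mulrC.
apply: le_trans (ler_normD _ _) _.
have bound (h k : nat -> int) : (forall i, `|h i| <= 1) -> (forall i, `|k i| <= B%:Z) ->
   `|\sum_(1 <= d < s.+1) h d * k d| <= s%:Z * B%:Z.
  move=> h1 kB; have := @norm_sum_nat_le (fun d => h d * k d) 1 s.+1 B%:Z.
  rewrite subSS subn0; apply => i; rewrite normrM -[leRHS]mul1r.
  by rewrite ler_pM.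
apply: le_trans (lerD (bound _ _ f1 (fun i => gB 1 (X %/ i).+1)%N)
   (bound _ _ g1 (fun i => fB s.+1 (X %/ i).+1)%N)) _.
lia.
Qed.

(** When chi is the character of a quadratic field, this is the number of ideals
    of norm N. *)
Definition divsum (chi : nat -> int) (N : nat) : int := \sum_(d <- divisors N) chi d.

Lemma big_divisors_nat (F : nat -> int) (N X : nat) : (0 < N)%N -> (N <= X)%N ->
  \sum_(d <- divisors N) F d = \sum_(1 <= d < X.+1 | (d %| N)%N) F d.
Proof.
move=> N0 NX; rewrite -[RHS]big_filter; apply: perm_big; apply: uniq_perm.
- exact: divisors_uniq.
- by rewrite filter_uniq // iota_uniq.
move=> d; rewrite -dvdn_divisors // mem_filter mem_index_iota.
case dN: (d %| N)%N => //=; have := dvdn_leq N0 dN; have := dvdn_gt0 N0 dN; lia.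
Qed.

Section DivisorSums.
Variable chi : nat -> int.
Hypothesis chi1 : chi 1%N = 1.
Hypothesis chiM : forall a b, chi (a * b)%N = chi a * chi b.
Hypothesis chi_sign : forall a, [\/ chi a = 0, chi a = 1 | chi a = -1].

Lemma chiX (a k : nat) : chi (a ^ k)%N = chi a ^+ k.
Proof. by elim: k => [|k IHk]; rewrite ?expn0 ?expnS ?chiM ?IHk ?exprS. Qed.

Lemma divisors_pfactor (p e m : nat) : prime p -> (0 < m)%N -> coprime p m ->
  perm_eq (divisors (p ^ e * m)) [seq (p ^ i * d)%N | i <- iota 0 e.+1, d <- divisors m].
Proof.
move=> p_pr m0 cpm; have p0 := prime_gt0 p_pr.
have logp i d : (d %| m)%N -> logn p (p ^ i * d) = i.
  move=> dm; have d0 := dvdn_gt0 m0 dm; have := coprime_dvdr dm cpm => cpd.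
  by rewrite lognM ?expn_gt0 ?p0 // pfactorK // (logn_coprime cpd) addn0.
have sP i : (i \in iota 0 e.+1) = (i < e.+1)%N by rewrite mem_iota.
have := iota_uniq 0 e.+1; move: (iota 0 e.+1) sP => s sP s_uniq.
apply: uniq_perm; first exact: divisors_uniq.
  apply: allpairs_uniq; rewrite ?s_uniq ?divisors_uniq //.
  move=> u v /allpairsP[u' [_ d1m ->]] /allpairsP[v' [_ d2m ->]].
  move: u' v' d1m d2m => [i1 d1] [i2 d2] /= d1m d2m eq_id.
  move: d1m d2m; rewrite -!dvdn_divisors // => d1m d2m.
  have eij : i1 = i2 by rewrite -(logp i1 d1) // eq_id logp.
  move: eq_id; rewrite eij => /eqP; rewrite eqn_pmul2l ?expn_gt0 ?p0 //.
  by move=> /eqP->.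
move=> d; rewrite -dvdn_divisors ?muln_gt0 ?expn_gt0 ?p0 //.
apply/idP/allpairsP => [dN|[[i d'] /= [ii dm ->]]]; last first.
  move: ii dm; rewrite sP -dvdn_divisors // => ii dm.
  by apply: dvdn_mul => //; apply: dvdn_exp2l; lia.
have d0 : (0 < d)%N by apply: dvdn_gt0 dN; rewrite muln_gt0 expn_gt0 p0.
have [d' cd' dE] := pfactor_coprime p_pr d0.
exists (logn p d, d'); rewrite /= mulnC -dE sP -dvdn_divisors //; split=> //.
  rewrite ltnS -(pfactorK e p_pr) -[X in (_ <= X)%N]addn0.
  rewrite -(logn_coprime cpm) -lognM ?expn_gt0 ?p0 // dvdn_leq_log //.
  by rewrite muln_gt0 expn_gt0 p0.
have cd'p : coprime d' (p ^ e) by rewrite coprime_sym coprimeXl.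
rewrite -(Gauss_dvdr _ cd'p); apply: dvdn_trans dN.
by rewrite dE dvdn_mulr.
Qed.

Lemma divsum_pfactor (p e m : nat) : prime p -> (0 < m)%N -> coprime p m ->
  divsum chi (p ^ e * m) = (\sum_(0 <= i < e.+1) chi p ^+ i) * divsum chi m.
Proof.
move=> p_pr m0 cpm; rewrite /divsum (perm_big _ (divisors_pfactor e p_pr m0 cpm)).
rewrite big_allpairs_dep mulr_suml /index_iota subn0; apply: eq_bigr => i _.
by rewrite mulr_sumr; apply: eq_bigr => d _; rewrite chiM chiX.
Qed.

Lemma alternating_sum (e : nat) : \sum_(0 <= i < e.+1) (-1) ^+ i = (~~ odd e)%:R :> int.
Proof.
elim: e => [|e IHe]; first by rewrite big_nat1.
by rewrite big_nat_recr //= IHe -signr_odd /=; case: odd.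
Qed.

Lemma geom_sum_ge0 (p e : nat) : 0 <= \sum_(0 <= i < e.+1) chi p ^+ i.
Proof.
have [->|->|->] := chi_sign p.
- by apply: sumr_ge0 => i _; rewrite exprn_ge0.
- by apply: sumr_ge0 => i _; rewrite expr1n.
by rewrite alternating_sum; case: odd.
Qed.

Lemma divsum_ge0 (N : nat) : 0 <= divsum chi N.
Proof.
elim/ltn_ind: N => N IHN; have [N1|N1] := leqP N 1.
  by case: N N1 IHN => [|[|N]] // _ _; rewrite /divsum big_seq1 chi1.
have p_pr := pdiv_prime N1; have N0 := ltnW N1.
have [m cpm NE] := pfactor_coprime p_pr N0.
have m0 : (0 < m)%N by rewrite lt0n; apply: contraTneq N0 => m0; rewrite NE m0.
rewrite NE mulnC divsum_pfactor // mulr_ge0 ?geom_sum_ge0 ?IHN //.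
rewrite [X in (_ < X)%N]NE ltn_Pmulr // -{1}(expn0 (pdiv N)) ltn_exp2l ?prime_gt1 //.
by rewrite logn_gt0 mem_primes p_pr N0 pdiv_dvd.
Qed.

(** The factor of the divisor sum at p is an alternating sum of signs, and that
    vanishes when it has an even number of terms. *)
Lemma divsum_neq0 (N p : nat) : (0 < N)%N -> prime p -> chi p = -1 ->
  divsum chi N != 0 -> ~~ odd (logn p N).
Proof.
move=> N0 p_pr chip; apply: contra => lo.
have [m cpm NE] := pfactor_coprime p_pr N0.
have m0 : (0 < m)%N by rewrite lt0n; apply: contraTneq N0 => m0; rewrite NE m0.
by rewrite NE mulnC divsum_pfactor // chip alternating_sum lo mul0r.
Qed.

Lemma chi_eq1 (N : nat) : (0 < N)%N ->
  (forall p, prime p -> (p %| N)%N -> chi p = 1) -> chi N = 1.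
Proof.
elim/ltn_ind: N => N IHN N0 splitN; have [N1|N1] := leqP N 1.
  by have -> : N = 1%N by lia.
have p_pr := pdiv_prime N1; have pN := pdiv_dvd N.
rewrite -(divnK pN) chiM (splitN _ p_pr pN) mulr1 IHN //.
- by rewrite ltn_Pdiv // prime_gt1.
- by rewrite divn_gt0; [exact: dvdn_leq N0 pN | exact: prime_gt0].
by move=> q q_pr qN; apply: splitN => //; apply: dvdn_trans qN (dvdn_div pN).
Qed.

Lemma divsum_ge1 (N : nat) : (0 < N)%N ->
  (forall p, prime p -> (p %| N)%N -> chi p = 1) -> 1 <= divsum chi N.
Proof.
move=> N0 splitN.
have all1 d : d \in divisors N -> chi d = 1.
  rewrite -dvdn_divisors // => dN; apply: chi_eq1 => [|p p_pr pd].
    exact: dvdn_gt0 dN.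
  by apply: splitN => //; apply: dvdn_trans pd dN.
rewrite /divsum (big_rem 1%N) /=; last by rewrite -dvdn_divisors.
rewrite chi1 lerDl big_seq; apply: sumr_ge0 => d /mem_rem /all1->.
by [].
Qed.
End DivisorSums.

(** * Numbers with prescribed genus characters *)

Lemma card_le_sum (T : finType) (g : T -> nat) (h : nat -> int) (X : nat) :
  injective g -> (forall t, 1 <= g t <= X)%N -> (forall N, 0 <= h N) ->
  (forall t, 1 <= h (g t)) -> #|T|%:Z <= \sum_(1 <= N < X.+1) h N.
Proof.
move=> g_inj gX h0 hg; pose s := [seq g t | t <- enum T].
have s_perm : perm_eq [seq N <- index_iota 1 X.+1 | N \in s] s.
  apply: uniq_perm; first by rewrite filter_uniq ?iota_uniq.
    by rewrite map_inj_uniq ?enum_uniq.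
  move=> N; rewrite mem_filter mem_index_iota ltnS andbC.
  by case: (boolP (N \in s)) => [/mapP[t _ ->]|]; rewrite ?gX ?andbF.
rewrite (bigID (fun N => N \in s)) /= -big_filter (perm_big _ s_perm) /=.
apply: ler_wpDr; first exact: sumr_ge0.
rewrite big_map big_enum /= -[#|T|%:Z]mulr1 -natz mulr_natl -sumr_const.
exact: ler_sum.
Qed.

Section GenusExistence.
Variables (I : finType) (M n : nat) (psi : I -> nat -> int) (eps : I -> int).
Hypotheses (I0 : (0 < #|I|)%N) (M1 : (1 < M)%N) (n0 : (0 < n)%N).
Hypothesis psiM : forall i a b, psi i (a * b)%N = psi i a * psi i b.
Hypothesis psi_one : forall i, psi i 1%N = 1.
Hypothesis psi_per : forall i a, psi i (a + M)%N = psi i a.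
Hypothesis psi_sign : forall i a, [\/ psi i a = 0, psi i a = 1 | psi i a = -1].
Hypothesis psi_sqr : forall i a, coprime a M -> psi i a ^+ 2 = 1.
Hypothesis psi_indep : forall A : {set I}, A != set0 ->
  exists2 a, coprime a M & \prod_(i in A) psi i a = -1.
Hypothesis eps_sqr : forall i, eps i ^+ 2 = 1.
Hypothesis eps_prod : \prod_i eps i = 1.
Let chi a := \prod_i psi i a.
Hypothesis chi_split : forall p u v : nat, prime p -> ~~ (p %| M)%N ->
  ~~ (p %| v)%N -> (p %| u ^ 2 + n * v ^ 2)%N -> chi p = 1.

Let unit a : int := (coprime a M)%:R.
Let f (A : {set I}) a := unit a * \prod_(i in A) psi i a.

Let f1 A a : `|f A a| <= 1.
Proof.
rewrite normrM mulr_ile1 //; first by rewrite /unit; case: coprime.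
rewrite normr_prod; apply: le_trans (_ : \prod_(i in A) 1 <= 1); last by rewrite big1.
by apply: ler_prod => i _; rewrite normr_ge0; case: (psi_sign i a) => ->.
Qed.

Let unitM a b : unit (a * b)%N = unit a * unit b.
Proof. by rewrite /unit coprimeMl -mulnb natrM. Qed.

Let fM A a b : f A (a * b)%N = f A a * f A b.
Proof.
rewrite /f unitM mulrACA -big_split; congr (_ * _).
by apply: eq_bigr => i _; rewrite psiM.
Qed.

Let f_per A a : f A (a + M)%N = f A a.
Proof.
rewrite /f /unit /coprime ![gcdn _ M]gcdnC gcdnDr; congr (_ * _).
by apply: eq_bigr => i _; rewrite psi_per.
Qed.

Let f_modn A a : f A (a %% M)%N = f A a.
Proof.
rewrite {2}(divn_eq a M) addnC; elim: (a %/ M)%N => [|k IHk]; first by rewrite addn0.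
by rewrite mulSn addnCA addnC f_per.
Qed.

(** Multiplication by a residue where the character is -1 permutes the period
    and changes the sign of the sum. *)
Let f_sum0 A : A != set0 -> \sum_(0 <= a < M) f A a = 0.
Proof.
move=> /psi_indep[b cbM psib]; rewrite big_mkord.
have M0 : (0 < M)%N := ltnW M1.
pose h (a : 'I_M) := Ordinal (ltn_pmod (b * a) M0).
have h_inj : injective h.
  move=> x y /(congr1 val) /=; wlog le_xy : x y / (x <= y)%N.
    by move=> IH e; case/orP: (leq_total x y) => l; [exact: IH | rewrite (IH y x)].
  move=> /esym/eqP; rewrite eqn_mod_dvd ?leq_mul2l ?le_xy ?orbT // -mulnBr.
  rewrite Gauss_dvdr 1?coprime_sym // => dv; apply/val_inj => /=.
  have := ltn_ord y; case: (posnP (y - x)%N) => [|gt0]; first lia.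
  have := dvdn_leq gt0 dv; lia.
have fb : f A b = -1 by rewrite /f psib /unit cbM mul1r.
have : \sum_(a < M) f A a = - \sum_(a < M) f A a.
  rewrite {1}(reindex_inj h_inj) /= -sumrN; apply: eq_bigr => a _.
  by rewrite f_modn fM fb mulN1r.
by move/eqP; rewrite -addr_eq0 -mulr2n mulrn_eq0 /= => /eqP.
Qed.

Let unit_sqr a (A : {set I}) : unit a * (\prod_(i in A) psi i a) ^+ 2 = unit a.
Proof.
rewrite /unit; case: (boolP (coprime a M)) => [ca|_]; last by rewrite mul0r.
by rewrite mul1r -prodrXl big1 // => i _; rewrite psi_sqr.
Qed.

Let chi_sign a : [\/ chi a = 0, chi a = 1 | chi a = -1].
Proof.
rewrite /chi; elim/big_rec: _ => [|i x _ IH]; first by constructor 2.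
by case: (psi_sign i a) => ->; case: IH => ->;
  [constructor 1|constructor 1|constructor 1|constructor 1|constructor 2|constructor 3|
   constructor 1|constructor 3|constructor 2].
Qed.

Let chiM a b : chi (a * b)%N = chi a * chi b.
Proof. by rewrite /chi -big_split; apply: eq_bigr => i _; exact: psiM. Qed.

Let chi_one : chi 1%N = 1.
Proof. by rewrite /chi big1 // => i _; exact: psi_one. Qed.

Let chi_setC (A : {set I}) a : f (~: A) a = f A a * chi a.
Proof.
have -> : chi a = (\prod_(i in A) psi i a) * \prod_(i in ~: A) psi i a.
  rewrite /chi (bigID (fun i => i \in A)) /=; congr (_ * _).
  by apply: eq_bigl => i; rewrite inE.
by rewrite /f -!mulrA [X in _ = _ * X]mulrA -expr2 mulrA unit_sqr.
Qed.

(** The twist of the divisor sum by one of the characters is the convolution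
    of two characters. *)
Let twist (A : {set I}) N : (0 < N)%N ->
  unit N * divsum chi N * \prod_(i in A) psi i N =
  \sum_(d <- divisors N) f (~: A) d * f A (N %/ d)%N.
Proof.
move=> N0; rewrite mulrAC /divsum mulr_sumr; apply: eq_big_seq => d.
rewrite -dvdn_divisors // => dN; rewrite -/(f A N) -[in LHS](divnK dN) fM.
by rewrite chi_setC; ring.
Qed.

Let S (A : {set I}) X := \sum_(1 <= N < X.+1) unit N * divsum chi N * \prod_(i in A) psi i N.

Let S_bound (A : {set I}) s : A != set0 -> A != setT -> (0 < s)%N ->
  `|S A (s ^ 2)| <= (2 * s * M)%N%:Z.
Proof.
move=> A0 AT s0; have M0 := ltnW M1.
have -> : S A (s ^ 2) = \sum_(1 <= N < (s ^ 2).+1)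
     \sum_(1 <= d < (s ^ 2).+1 | (d %| N)%N) f (~: A) d * f A (N %/ d)%N.
  apply: eq_big_nat => N /andP[N0 NX]; rewrite twist //.
  exact: (@big_divisors_nat (fun d => f (~: A) d * f A (N %/ d)%N)).
apply: hyperbola_bound; try exact: f1; try nia.
- apply: periodic_sum_bound => //; apply: f_sum0.
  by rewrite -(inj_eq (@setC_inj _)) setCK setC0.
- by apply: periodic_sum_bound => //; apply: f_sum0.
Qed.

Let S_set0 X : S set0 X = \sum_(1 <= N < X.+1) unit N * divsum chi N.
Proof. by apply: eq_bigr => N _; rewrite big1 ?mulr1 // => i; rewrite inE. Qed.

(** Twisting by chi itself merely exchanges complementary divisors. *)
Let S_setT X : S setT X = \sum_(1 <= N < X.+1) unit N * divsum chi N.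
Proof.
apply: eq_big_nat => N /andP[N0 _].
have div_perm : perm_eq (divisors N) [seq (N %/ d)%N | d <- divisors N].
  have divl d : d \in divisors N -> (N %/ d)%N \in divisors N.
    by rewrite -!dvdn_divisors //; exact: dvdn_div.
  have divK d : d \in divisors N -> (N %/ (N %/ d))%N = d.
    by rewrite -dvdn_divisors // => dN; rewrite divnA // mulKn.
  apply: uniq_perm; rewrite ?map_inj_in_uniq ?divisors_uniq //.
    by move=> d e dN eN de; rewrite -(divK d dN) de divK.
  move=> d; apply/idP/mapP => [dN|[e eN ->]]; last exact: divl.
  by exists (N %/ d)%N; rewrite ?divl ?divK.
rewrite /unit; case: (boolP (coprime N M)) => [cN|_]; last by rewrite !mul0r.
rewrite !mul1r (eq_bigl predT) -/(chi N); last by move=> i; rewrite inE.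
rewrite [RHS]/divsum (perm_big _ div_perm) big_map /=.
rewrite /divsum mulr_suml; apply: eq_big_seq => d; rewrite -dvdn_divisors // => dN.
rewrite -{1}(divnK dN) chiM mulrCA -expr2 {2}/chi -prodrXl big1 ?mulr1 // => i _.
by rewrite psi_sqr //; apply: coprime_dvdl dN cN.
Qed.

Let genus_expand X :
  \sum_(1 <= N < X.+1) unit N * divsum chi N * \prod_i (1 + eps i * psi i N) =
  \sum_(A : {set I}) (\prod_(i in A) eps i) * S A X.
Proof.
transitivity (\sum_(1 <= N < X.+1) \sum_(A : {set I})
   (\prod_(i in A) eps i) * (unit N * divsum chi N * \prod_(i in A) psi i N)).
  apply: eq_bigr => N _.
  have -> : \prod_i (1 + eps i * psi i N) = \sum_(A : {set I}) \prod_(i in A) (eps i * psi i N).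
    under eq_bigr do rewrite addrC.
    rewrite bigA_distr; apply: eq_bigr => A _.
    by rewrite [RHS]big_mkcond.
  rewrite mulr_sumr; apply: eq_bigr => A _.
  by rewrite big_split /= mulrCA.
by rewrite exchange_big /=; apply: eq_bigr => A _; rewrite mulr_sumr.
Qed.

(** The values u^2 + n v^2 with u = 1 mod M and v a power of M are prime to M,
    and by the splitting hypothesis chi is 1 on all their divisors. The bound
    n v^2 <= K < u keeps each of them between u^2 and (u + 1)^2, so that they are
    V K distinct integers, and the factor V can be made as large as needed. *)
Let genus_lower (V K : nat) : (0 < V)%N -> K = (n * M ^ (2 * V))%N ->
  (V * K)%N%:Z <= \sum_(1 <= N < ((2 * M * K) ^ 2).+1) unit N * divsum chi N.
Proof.
move=> V0 KE; have M0 := ltnW M1.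
have K0 : (0 < K)%N by rewrite KE muln_gt0 n0 expn_gt0 M0.
pose u (k : 'I_K) := (M * (K + k) + 1)%N; pose v (j : 'I_V) := (M ^ j.+1)%N.
pose g (jk : 'I_V * 'I_K) := (u jk.2 ^ 2 + n * v jk.1 ^ 2)%N.
have vK j : (n * v j ^ 2 <= K)%N.
  rewrite KE leq_mul2l; apply/orP; right; rewrite /v -expnM leq_pexp2l //.
  by have := ltn_ord j; lia.
have uK k : (K < u k)%N by rewrite /u; nia.
have sqrt_g j k : (u k ^ 2 < g (j, k) < (u k).+1 ^ 2)%N.
  rewrite /g /=; have := vK j; have := uK k.
  have : (0 < n * v j ^ 2)%N by rewrite muln_gt0 n0 expn_gt0 /v expn_gt0 M0.
  by move: (n * v j ^ 2)%N (u k) => w x; nia.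
have g_inj : injective g.
  move=> [j k] [j' k'] eq_g.
  have eu : u k = u k'.
    have := sqrt_g j k; have := sqrt_g j' k'; rewrite eq_g.
    by move: (g _) (u k) (u k') => w x y; nia.
  have ek : k = k' by apply/val_inj; move: eu; rewrite /u /=; nia.
  move: eq_g; rewrite /g /= ek => /eqP; rewrite eqn_add2l eqn_pmul2l // eqn_sqr.
  by rewrite /v eqn_exp2l // => /eqP[ej]; congr (_, _); apply/val_inj.
have g_mod jk : coprime (g jk) M.
  rewrite /g /u /v -!mulnn expnS.
  have -> : ((M * (K + jk.2) + 1) * (M * (K + jk.2) + 1) +
    n * (M * M ^ jk.1 * (M * M ^ jk.1)) = ((K + jk.2) * (M * (K + jk.2) + 2)
     + n * (M ^ jk.1 * (M * M ^ jk.1))) * M + 1)%N by ring.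
  by rewrite /coprime gcdnC gcdnMDl gcdn1.
have -> : (V * K)%N = #|{: 'I_V * 'I_K}| by rewrite card_prod !card_ord.
apply: card_le_sum g_inj _ _ _ => [[j k]|N|jk].
- have := sqrt_g j k; have : ((u k).+1 <= 2 * M * K)%N by rewrite /u; have := ltn_ord k; nia.
  by rewrite -leq_sqr; move: (g _) (u k) (2 * M * K)%N => w x y; lia.
- rewrite mulr_ge0 ?divsum_ge0 //; exact: ler0n.
rewrite /unit g_mod mul1r; apply: divsum_ge1 => // [|p p_pr pg].
  by case: jk => j k; have := sqrt_g j k; move: (g _) (u k) => w x; lia.
have pM : ~~ (p %| M)%N.
  rewrite -prime_coprime //; apply: coprime_dvdl pg (g_mod jk).
apply: (chi_split p_pr pM _ pg).
by apply: contra pM; rewrite /v Euclid_dvdX // => /andP[].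
Qed.

(** Existence of numbers N with prescribed values of all characters psi_i and
    with divsum chi N nonzero; this replaces the primes that Dirichlet's theorem
    would give. In the sum of divsum chi N times the product of the factors
    1 + eps_i psi_i(N), the term of a set A other than the empty and the full one
    convolves two nonprincipal characters, so the hyperbola method makes it
    O(sqrt X). The two remaining terms are equal and of larger order. If no such
    N existed, the whole sum would vanish. *)
Lemma genus_divisor_sum : exists N, [/\ (0 < N)%N, coprime N M,
  forall i, psi i N = eps i & divsum chi N != 0].
Proof.
have M0 := ltnW M1.
(* With X = s^2 and s = 2 M K, the at most 2^#|I| twisted sums are bounded by
   2 s M each, the two untwisted ones are at least V K each. *)
pose V := (2 ^ #|I| * (2 * M ^ 2) + 1)%N; pose K := (n * M ^ (2 * V))%N.
have K0 : (0 < K)%N by rewrite muln_gt0 n0 expn_gt0 M0.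
pose s := (2 * M * K)%N; pose X := (s ^ 2)%N.
have s0 : (0 < s)%N by rewrite /s muln_gt0 K0 muln_gt0 M0.
case: (boolP [exists N : 'I_X.+1, [&& (0 < N)%N, coprime N M,
    [forall i, psi i N == eps i] & divsum chi N != 0]]) => [/existsP[N]|none].
  case/and4P => N0 NM /forallP Neps Nchi; exists N; split=> // i.
  exact/eqP.
have lower : (V * K)%N%:Z <= S set0 X.
  by rewrite S_set0; apply: genus_lower; [rewrite /V addn1|exact: erefl].
have T0 : setT != set0 :> {set I} by rewrite -card_gt0 cardsT.
have := genus_expand X; rewrite big_nat_cond big1 => [|N]; last first.
  rewrite andbT => /andP[N0 NX]; rewrite /unit.
  case: (boolP (coprime N M)) => NM; last by rewrite !mul0r.
  case: (eqVneq (divsum chi N) 0) => [->|Nchi]; first by rewrite mulr0 mul0r.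
  have [i Ni] : exists i, psi i N != eps i.
    apply/existsP; apply: contraR none; rewrite negb_exists => /forallP all_eps.
    apply/existsP; exists (Ordinal NX); rewrite /= N0 NM Nchi andbT.
    by apply/forallP => i; have := all_eps i; rewrite negbK.
  rewrite (bigD1 i) //=; have -> : 1 + eps i * psi i N = 0; last by rewrite mul0r mulr0.
  have : (psi i N - eps i) * (psi i N + eps i) == 0.
    by rewrite -subr_sqr psi_sqr // eps_sqr subrr.
  rewrite mulf_eq0 subr_eq0 (negPf Ni) /= addr_eq0 => /eqP ->.
  by rewrite mulrN -expr2 eps_sqr subrr.
rewrite (bigD1 set0) // (bigD1 setT) //= S_setT -S_set0.
rewrite big1 ?mul1r => [|i]; last by rewrite inE.
rewrite (eq_bigl predT) => [|i]; last by rewrite inE.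
rewrite eps_prod mul1r => /esym/eqP; rewrite addrA addr_eq0 => /eqP eqL.
have : `|\sum_(A | (A != set0) && (A != setT)) (\prod_(i in A) eps i) * S A X|
    <= (2 ^ #|I| * (2 * s * M))%N%:Z.
  apply: le_trans (ler_norm_sum _ _ _) _.
  apply: le_trans (_ : \sum_(A : {set I}) (2 * s * M)%N%:Z <= _); last first.
    have cardI : #|{set I}| = (2 ^ #|I|)%N by rewrite -[LHS]cardsT -powersetT card_powerset cardsT.
    rewrite sumr_const cardI -mulr_natl natz; lia.
  rewrite [X in X <= _]big_mkcond; apply: ler_sum => A _.
  case: ifP => [/andP[A0 AT]|_]; last by [].
  rewrite normrM -[leRHS]mul1r ler_pM ?normr_ge0 // ?S_bound //.
  rewrite normr_prod big1 // => i _.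
  by have /eqP := eps_sqr i; rewrite sqrf_eq1 => /orP[]/eqP->.
have upper : 2 * S set0 X <= (2 ^ #|I| * (2 * s * M))%N%:Z -> False.
  move: lower; rewrite /V /s; move: (S set0 X) (2 ^ #|I|)%N => L C; nia.
move=> h; case: upper; apply: le_trans h.
have -> : 2 * S set0 X = S set0 X + S set0 X by ring.
by rewrite eqL ler_normr lexx orbT.
Qed.
End GenusExistence.

(** * Ternary quadratic forms of determinant 1 *)

(** The quadratic form of the symmetric matrix with rows (a, t, s), (t, b, r)
    and (s, r, c). *)
Definition ternary (a b c r s t x y z : int) : int :=
  a * x ^+ 2 + b * y ^+ 2 + c * z ^+ 2 + 2 * (r * y * z + s * x * z + t * x * y).

Lemma centered_shift (d m : int) : 0 < m -> exists k, `|2 * (d + k * m)| <= m.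
Proof.
move=> m0; exists (- ((2 * d + m) %/ (2 * m))%Z).
have := divz_eq (2 * d + m) (2 * m).
have := modz_ge0 (2 * d + m) (lt0r_neq0 (_ : 0 < 2 * m)).
have := ltz_pmod (2 * d + m) (_ : 0 < 2 * m).
move: (_ %/ _)%Z (_ %% _)%Z => q w; lia.
Qed.

Lemma absz_lt (x y : int) : 0 < x -> x < y -> (`|x| < `|y|)%N.
Proof. lia. Qed.

Lemma sqr_half_le (d m : int) : `|2 * d| <= m -> 4 * d ^+ 2 <= m ^+ 2.
Proof.
move=> dm; have -> : 4 * d ^+ 2 = `|2 * d| ^+ 2 by rewrite real_normK ?num_real //; ring.
by rewrite ler_sqr ?nnegrE ?normr_ge0 //; apply: le_trans dm.
Qed.

Lemma binary_reduced_bound (a B C D : int) :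
  B * C = a + D ^+ 2 -> 0 < B -> B <= C -> `|2 * D| <= B -> 3 * B ^+ 2 <= 4 * a.
Proof.
move=> BCD B0 BC /sqr_half_le DB.
have : B ^+ 2 <= B * C by rewrite expr2 ler_pM2l.
lia.
Qed.

Lemma ternary_reduced_lt (a b t B : int) :
  2 <= a -> 0 < B -> 3 * B ^+ 2 <= 4 * a -> `|2 * t| <= a ->
  a * b - t ^+ 2 = B -> b < a.
Proof.
move=> a2 B0 Ba /sqr_half_le ta abE.
have Ba2 : 4 * B < 3 * a ^+ 2.
  have [//|Bbig] := ltP (4 * B) (3 * a ^+ 2).
  have h1 : (3 * a ^+ 2) ^+ 2 <= (4 * B) ^+ 2 by rewrite ler_sqr ?nnegrE //; nia.
  have h2 : 8 * a <= a ^+ 4.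
    rewrite (exprS a 3) mulrC ler_pM2l; last lia.
    by apply: le_trans (_ : 2 ^+ 3 <= _) => //; rewrite lerXn2r ?nnegrE //; lia.
  have h3 : (3 * a ^+ 2) ^+ 2 = 9 * a ^+ 4 by ring.
  have h4 : (4 * B) ^+ 2 = 16 * B ^+ 2 by ring.
  rewrite h3 h4 in h1; lia.
rewrite -(ltr_pM2l (_ : 0 < a)); last lia.
lia.
Qed.

(** Hermite reduction, by descent on a and then on B = a b - t^2. The vectors
    e2 and e3 span, modulo e1, a binary form B y^2 + 2 D y z + C z^2 of
    determinant a. Unless C < B, when exchanging e2 and e3 lowers B, that form is
    reduced and 3 B^2 <= 4 a. Then a = 1, where the form is a sum of squares, or
    a vector e2 + m e1 has a value below a and can take the place of e1. *)
Lemma ternary_sum3 (a b c r s t : int) :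
  0 < a -> 0 < a * b - t ^+ 2 ->
  a * b * c + 2 * r * s * t - a * r ^+ 2 - b * s ^+ 2 - c * t ^+ 2 = 1 ->
  forall x y z, exists u v w : int, ternary a b c r s t x y z = u ^+ 2 + v ^+ 2 + w ^+ 2.
Proof.
move: {2}`|a|%N (erefl `|a|%N) => k; elim/ltn_ind: k a b c r s t => k IHk a b c r s t ak.
move: {2}(absz (a * b - t ^+ 2)%R) (erefl (absz (a * b - t ^+ 2)%R)) => l.
elim/ltn_ind: l b c r s t => l IHl b c r s t bl a0.
set B := a * b - t ^+ 2 => B0 det1 x y z.
have [m Dm] := centered_shift (a * r - s * t) B0.
pose r1 := r + b * m; pose s1 := s + t * m; pose c1 := c + 2 * r * m + b * m ^+ 2.
have -> : ternary a b c r s t x y z = ternary a b c1 r1 s1 t x (y - m * z) z.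
  by rewrite /ternary /c1 /r1 /s1; ring.
move: (y - m * z) => {}y.
have det2 : a * b * c1 + 2 * r1 * s1 * t - a * r1 ^+ 2 - b * s1 ^+ 2 - c1 * t ^+ 2 = 1.
  by rewrite -[RHS]det1 /c1 /r1 /s1; ring.
have DE : a * r1 - s1 * t = a * r - s * t + m * B by rewrite /r1 /s1 /B; ring.
rewrite -DE in Dm; clear DE det1; clearbody c1 r1 s1.
move: {r s c m} c1 r1 s1 det2 Dm => c r s det1 Dm.
set D := a * r - s * t in Dm; pose C := a * c - s ^+ 2.
have BCD : B * C = a + D ^+ 2.
  apply/eqP; rewrite -subr_eq -[X in _ == X]mulr1 -[X in a * X]det1.
  by apply/eqP; rewrite /B /C /D; ring.
have C0 : 0 < C.
  by rewrite -(pmulr_rgt0 _ B0) BCD; apply: ltr_wpDr (sqr_ge0 _) a0.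
have [CB|BC] := ltP C B.
  have Cl : (`|C| < l)%N by rewrite -bl; apply: absz_lt.
  have [u [v [w e]]] := IHl _ Cl c b r t s erefl a0 C0
    (ltac:(by rewrite -[RHS]det1; ring)) x z y.
  by exists u, v, w; rewrite -e /ternary; ring.
have B_small := binary_reduced_bound BCD B0 BC Dm.
have [a1|a2] : a = 1 \/ 2 <= a by lia.
  have B1 : B = 1 by move: B_small B0; rewrite a1; clearbody B; clear; nia.
  have D0 : D = 0 by move: Dm; rewrite B1; lia.
  have C1 : C = 1 by move: BCD; rewrite B1 D0 a1; lia.
  exists (x + t * y + s * z), y, z.
  have -> : ternary a b c r s t x y z =
     (x + t * y + s * z) ^+ 2 + B * y ^+ 2 + 2 * D * y * z + C * z ^+ 2.
    by rewrite /B /C /D a1 /ternary; ring.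
  by rewrite B1 C1 D0; ring.
have [m' tm] := centered_shift t a0.
pose t1 := t + m' * a; pose b1 := b + 2 * t * m' + a * m' ^+ 2; pose r1 := r + s * m'.
have -> : ternary a b c r s t x y z = ternary b1 a c s r1 t1 y (x - m' * y) z.
  by rewrite /ternary /b1 /r1 /t1; ring.
have BE : a * b1 - t1 ^+ 2 = B by rewrite /b1 /t1 /B; ring.
rewrite -/t1 in tm.
have b10 : 0 < b1.
  have : 0 < a * b1 by rewrite -[a * b1](subrK (t1 ^+ 2)) BE ltr_wpDr ?sqr_ge0.
  by rewrite pmulr_rgt0.
have lt_b1a := ternary_reduced_lt a2 B0 B_small tm BE.
have b1k : (`|b1| < k)%N by rewrite -ak; apply: absz_lt.
apply: (IHk _ b1k _ _ _ _ _ _ erefl b10); first by rewrite mulrC BE.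
by rewrite -[RHS]det1 /b1 /t1 /r1; ring.
Qed.

(** The binary form (al, beta, N) with al N = beta^2 + n has determinant n.
    Choosing r with r s = -beta mod n makes it congruent modulo n to minus the
    square of r x + s y. Hence al x^2 + 2 beta x y + N y^2 + (r x + s y + n z)^2
    is n times an integral form; that form has determinant 1 and takes the value
    n at (0, 0, 1). *)
Lemma three_squares_of_residues (n N beta s : int) :
  0 < n -> 0 < N -> coprimez N n ->
  (N %| beta ^+ 2 + n)%Z -> (n %| s ^+ 2 + N)%Z ->
  exists u v w : int, n = u ^+ 2 + v ^+ 2 + w ^+ 2.
Proof.
move=> n0 N0 cop /dvdzP[al alE] /dvdzP[b bE].
have /coprimezP[[k l] /= kl] := cop.
pose r := beta * s * k.
have al0 : 0 < al.
  by rewrite -(pmulr_lgt0 _ N0) -alE ltr_wpDl ?sqr_ge0.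
have e1 : beta ^+ 2 + n - al * N = 0 by rewrite alE subrr.
have e2 : s ^+ 2 + N - b * n = 0 by rewrite bE subrr.
have e3 : k * N + l * n - 1 = 0 by rewrite kl subrr.
have [a aE] : exists a, a * n = al + r ^+ 2.
  exists (al * l * (1 + k * N) + beta ^+ 2 * k ^+ 2 * b + k ^+ 2 * N).
  apply/esym/eqP; rewrite -subr_eq0; apply/eqP; rewrite /r.
  transitivity (beta ^+ 2 * k ^+ 2 * (s ^+ 2 + N - b * n)
    - N * k ^+ 2 * (beta ^+ 2 + n - al * N) - al * (1 + k * N) * (k * N + l * n - 1)).
    by ring.
  by rewrite e1 e2 e3; ring.
have [t tE] : exists t, t * n = beta + r * s.
  exists (beta * (l + b * k)).
  apply/esym/eqP; rewrite -subr_eq0; apply/eqP; rewrite /r.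
  transitivity (beta * (k * (s ^+ 2 + N - b * n) - (k * N + l * n - 1))); first by ring.
  by rewrite e2 e3; ring.
clearbody r.
have alE' : al = a * n - r ^+ 2 by rewrite aE addrK.
have NE : N = b * n - s ^+ 2 by rewrite -bE addrC addKr.
have betaE : beta = t * n - r * s by rewrite tE addrK.
have det1 : n * (a * b - t ^+ 2) - (a * s ^+ 2 + b * r ^+ 2 - 2 * t * r * s) = 1.
  apply: (mulfI (lt0r_neq0 n0)); rewrite mulr1.
  transitivity ((a * n - r ^+ 2) * (b * n - s ^+ 2) - (t * n - r * s) ^+ 2); first by ring.
  by rewrite -alE' -NE -betaE -alE; ring.
have a0 : 0 < a.
  by rewrite -(pmulr_lgt0 _ n0) aE ltr_wpDr ?sqr_ge0.
have delta0 : 0 < a * b - t ^+ 2.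
  rewrite -(pmulr_rgt0 _ al0).
  have -> : al * (a * b - t ^+ 2) = a + (a * s - t * r) ^+ 2.
    transitivity (a * (n * (a * b - t ^+ 2) - (a * s ^+ 2 + b * r ^+ 2 - 2 * t * r * s))
      + (a * s - t * r) ^+ 2); first by rewrite alE'; ring.
    by rewrite det1 mulr1.
  by rewrite ltr_wpDr ?sqr_ge0.
have det2 : a * b * n + 2 * s * r * t - a * s ^+ 2 - b * r ^+ 2 - n * t ^+ 2 = 1.
  by rewrite -[RHS]det1; ring.
have [u [v [w e]]] := ternary_sum3 a0 delta0 det2 0 0 1.
by exists u, v, w; rewrite -e /ternary; ring.
Qed.

(** * Squares modulo squarefree numbers *)

Definition sqmod (m : nat) (a : int) := exists b : int, (m %| b ^+ 2 - a)%Z.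
Definition sqfree (n : nat) := forall p, prime p -> (logn p n <= 1)%N.

Lemma sqfree_decomp (N : nat) : (0 < N)%N -> exists N0 k : nat,
  [/\ N = (N0 * k ^ 2)%N, (0 < N0)%N, (0 < k)%N & forall p, logn p N0 = odd (logn p N)].
Proof.
elim/ltn_ind: N => N IHN N0.
have [/allP small|/allPn[p]] := boolP (all (fun p => logn p N <= 1)%N (primes N)).
  exists N, 1%N; split; rewrite ?muln1 // => p.
  case: (posnP (logn p N)) => [->//|]; rewrite logn_gt0 => /small.
  by case: (logn p N) => [|[|]].
rewrite mem_primes -ltnNge => /and3P[p_pr _ pN] lp.
have p0 := prime_gt0 p_pr.
have p2N : (p ^ 2 %| N)%N by rewrite pfactor_dvdn.
have NE := divnK p2N; set N' := (N %/ p ^ 2)%N in NE.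
have N'0 : (0 < N')%N by rewrite divn_gt0 ?expn_gt0 ?p0 // dvdn_leq.
have N'N : (N' < N)%N by rewrite ltn_Pdiv // -(exp1n 2) ltn_sqr prime_gt1.
have [M [k [N'E M0 k0 lM]]] := IHN _ N'N N'0.
exists M, (k * p)%N; split=> // [||q].
- by rewrite -NE {1}N'E expnMn mulnA.
- by rewrite muln_gt0 k0.
by rewrite lM -NE lognM ?expn_gt0 ?p0 // oddD lognX oddM addbF.
Qed.

Lemma dvdz_sqr_congr (m : int) (x y c : int) :
  (x = y %[mod m])%Z -> (m %| y ^+ 2 - c)%Z -> (m %| x ^+ 2 - c)%Z.
Proof.
move=> /eqP; rewrite eqz_mod_dvd => /dvdzP[q xy] /dvdzP[k yc].
apply/dvdzP; exists (q * (x + y) + k).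
have -> : x ^+ 2 - c = (x - y) * (x + y) + (y ^+ 2 - c) by ring.
by rewrite xy yc; ring.
Qed.

Lemma sqmodM (a b : nat) (c : int) : coprime a b -> sqmod a c -> sqmod b c -> sqmod (a * b) c.
Proof.
move=> cab [x xa] [y yb]; have cab' : coprimez a b by [].
exists (zchinese a b x y); rewrite PoszM Gauss_dvdz //; apply/andP; split.
  exact: dvdz_sqr_congr (zchinese_modl cab' x y) xa.
exact: dvdz_sqr_congr (zchinese_modr cab' x y) yb.
Qed.

Lemma sqmod_sqfree (m : nat) (c : int) : (0 < m)%N -> sqfree m ->
  (forall p, prime p -> (p %| m)%N -> sqmod p c) -> sqmod m c.
Proof.
elim/ltn_ind: m => m IHm m0 sfm sqp; have [m1|m1] := leqP m 1.
  by exists 0; have -> : m = 1%N by lia.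
have p_pr := pdiv_prime m1; have [k cpk mE] := pfactor_coprime p_pr m0.
have l1 : logn (pdiv m) m = 1%N.
  apply/eqP; rewrite eqn_leq sfm //= logn_gt0 mem_primes p_pr m0 pdiv_dvd //.
have k0 : (0 < k)%N by rewrite lt0n; apply: contraTneq m0 => k0; rewrite mE k0.
rewrite mE l1 expn1 mulnC; apply: sqmodM => //; first by apply: sqp; rewrite ?pdiv_dvd.
rewrite l1 expn1 in mE.
apply: IHm => //.
- by rewrite [X in (_ < X)%N]mE ltn_Pmulr // prime_gt1.
- move=> q q_pr; apply: leq_trans (sfm q q_pr).
  by rewrite [X in (_ <= logn q X)%N]mE dvdn_leq_log ?dvdn_mulr // -mE.
by move=> q q_pr qk; apply: sqp => //; rewrite mE dvdn_mulr.
Qed.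

(** * Genus characters of a squarefree number *)

Section PeriodicSigns.
Variable c : nat -> int.
Hypothesis c_per : forall a, c a = c (a %% 8)%N.

Lemma mod8_mult : all (fun a => all (fun b => c (a * b)%N == c a * c b) (iota 0 8)) (iota 0 8) ->
  forall a b, c (a * b)%N = c a * c b.
Proof.
move=> /allP tab a b.
have in8 x : (x %% 8 \in iota 0 8)%N by rewrite mem_iota ltn_mod.
rewrite c_per (c_per a) (c_per b) -modnMm -c_per.
by have /allP/(_ _ (in8 b))/eqP := tab _ (in8 a).
Qed.
End PeriodicSigns.

Lemma chi4_mod8 a : chi4 a = chi4 (a %% 8)%N.
Proof.
rewrite /chi4; have -> : odd (a %% 8) = odd a by lia.
by have -> : (a %% 8 %% 4 = a %% 4)%N by lia.
Qed.

Lemma chi8_mod8 a : chi8 a = chi8 (a %% 8)%N.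
Proof. by rewrite /chi8 modn_mod; have -> : odd (a %% 8) = odd a by lia. Qed.

Lemma chi4M a b : chi4 (a * b)%N = chi4 a * chi4 b.
Proof. exact: (mod8_mult chi4_mod8). Qed.

Lemma chi8M a b : chi8 (a * b)%N = chi8 a * chi8 b.
Proof. exact: (mod8_mult chi8_mod8). Qed.

Lemma chi4_sqr a : odd a -> chi4 a ^+ 2 = 1.
Proof. by rewrite /chi4 => ->; case: ifP. Qed.

Lemma chi8_sqr a : odd a -> chi8 a ^+ 2 = 1.
Proof. by rewrite /chi8 => ->; case: ifP. Qed.

(** The nonprincipal real Dirichlet characters of modulus 8. *)
Record dyadic (c : nat -> int) : Prop := Dyadic {
  dyadicM : forall a b, c (a * b)%N = c a * c b;
  dyadic1 : c 1%N = 1;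
  dyadic_per : forall a, c a = c (a %% 8)%N;
  dyadic_sign : forall a, [\/ c a = 0, c a = 1 | c a = -1];
  dyadic_sqr : forall a, odd a -> c a ^+ 2 = 1;
  dyadic_neg : exists2 a, odd a & c a = -1 }.

Lemma sign_sqr1 (x : int) : x ^+ 2 = 1 -> [\/ x = 0, x = 1 | x = -1].
Proof. by move/eqP; rewrite sqrf_eq1 => /orP[]/eqP->; [constructor 2|constructor 3]. Qed.

Lemma dyadic_chi4 : dyadic chi4.
Proof.
split; [exact: chi4M|by []|exact: chi4_mod8| |exact: chi4_sqr|by exists 3%N].
by move=> a; rewrite /chi4; do ?case: ifP => _; [constructor 2|constructor 3|constructor 1].
Qed.

Lemma dyadic_chi8 : dyadic chi8.
Proof.
split; [exact: chi8M|by []|exact: chi8_mod8| |exact: chi8_sqr|by exists 3%N].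
by move=> a; rewrite /chi8; do ?case: ifP => _; [constructor 2|constructor 3|constructor 1].
Qed.

Lemma dyadic_chi4_chi8 : dyadic (fun a => chi4 a * chi8 a).
Proof.
split; [|by []| | | |by exists 5%N].
- by move=> a b; rewrite chi4M chi8M mulrACA.
- by move=> a; rewrite chi4_mod8 chi8_mod8.
- move=> a; have [h|h] := boolP (odd a); last by rewrite /chi4 (negPf h) mul0r; constructor 1.
  by apply: sign_sqr1; rewrite exprMn chi4_sqr // chi8_sqr // mulr1.
by move=> a h; rewrite exprMn chi4_sqr // chi8_sqr // mulr1.
Qed.

Lemma sqfree_primes (m : nat) : (0 < m)%N -> sqfree m -> (\prod_(q <- primes m) q)%N = m.
Proof.
move=> m0 sfm; rewrite [RHS]prod_prime_decomp // prime_decompE big_map /=.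
rewrite !big_seq; apply: eq_bigr => q; rewrite mem_primes => /and3P[q_pr _ qm].
have : (0 < logn q m)%N by rewrite logn_gt0 mem_primes q_pr m0.
by have := sfm q q_pr; case: (logn q m) => [|[|]] // _ _; rewrite expn1.
Qed.

Lemma mult_prod_seq (c : nat -> int) (s : seq nat) :
  c 1%N = 1 -> (forall a b, c (a * b)%N = c a * c b) ->
  \prod_(q <- s) c q = c (\prod_(q <- s) q)%N.
Proof.
by move=> c1 cM; elim: s => [|q s IHs]; rewrite ?big_nil // !big_cons cM IHs.
Qed.

Lemma leg_prod (p : nat) (s : seq int) : prime p -> odd p ->
  \prod_(q <- s) leg p q = leg p (\prod_(q <- s) q).
Proof.
move=> p_pr p_odd; elim: s => [|q s IHs]; first by rewrite !big_nil leg1.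
by rewrite !big_cons legM // IHs.
Qed.

Lemma primes_odd (m q : nat) : odd m -> q \in primes m -> odd q.
Proof.
by move=> m_odd; rewrite mem_primes => /and3P[_ _] /dvdn_odd; apply.
Qed.

(** Reciprocity for the Jacobi symbol with squarefree lower entry m. *)
Lemma prod_leg_flip (m p : nat) : odd m -> sqfree m -> prime p -> odd p -> ~~ (p %| m)%N ->
  \prod_(q <- primes m) leg q p = leg p (chi4 m * m%:Z).
Proof.
move=> m_odd sfm p_pr p_odd pm; have m0 : (0 < m)%N by case: m m_odd {sfm pm}.
have -> : chi4 m * m%:Z = \prod_(q <- [seq chi4 q * q%:Z | q <- primes m]) q.
  rewrite big_map big_split /= (mult_prod_seq _ (erefl : chi4 1 = 1) chi4M).
  by rewrite -(big_morph Posz PoszM (erefl _)) !sqfree_primes.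
rewrite -leg_prod // [RHS]big_map big_seq [RHS]big_seq; apply: eq_bigr => q qm.
have q_odd := primes_odd m_odd qm; move: qm; rewrite mem_primes => /and3P[q_pr _ qm].
rewrite quadratic_reciprocity //; apply: contraNneq pm => -> //.
Qed.

Section GenusOfSquarefree.
Variables (m n : nat) (b : bool) (c2 : nat -> int) (eps : nat -> int).
Hypotheses (m_odd : odd m) (sfm : sqfree m) (n0 : (0 < n)%N) (c2P : dyadic c2).

(** The character attached to the prime q of the discriminant; at 2 it is one
    of the three dyadic characters, depending on the number considered. *)
Definition genus_char (q a : nat) : int := if q == 2%N then c2 a else leg q a.
Definition genus_primes : seq nat := if b then 2%N :: primes m else primes m.
Local Notation char := genus_char.
Local Notation s := genus_primes.

Hypothesis s_neq0 : s != [::].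
Hypothesis eps_sqr : forall q, q \in s -> eps q ^+ 2 = 1.
Hypothesis eps_prod : \prod_(q <- s) eps q = 1.
Hypothesis split : forall p u v : nat, prime p -> ~~ (p %| 8 * m)%N ->
  ~~ (p %| v)%N -> (p %| u ^ 2 + n * v ^ 2)%N -> \prod_(q <- s) char q p = 1.

Let m0 : (0 < m)%N. Proof. by case: m m_odd. Qed.

Let s_uniq : uniq s.
Proof.
rewrite /s; case: b; rewrite /= ?primes_uniq // andbT.
by apply/negP => /(primes_odd m_odd).
Qed.

Let s_prime q : q \in s -> q = 2%N \/ [/\ prime q, odd q & (q %| m)%N].
Proof.
have aux : q \in primes m -> [/\ prime q, odd q & (q %| m)%N].
  by move=> qm; have := primes_odd m_odd qm; move: qm; rewrite mem_primes => /and3P[].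
rewrite /s; case: b => [|/aux]; last by right.
by rewrite inE => /orP[/eqP|/aux]; [left|right].
Qed.

Let charM q a a' : q \in s -> char q (a * a')%N = char q a * char q a'.
Proof.
move=> /s_prime[->|[q_pr q_odd _]]; first exact: dyadicM c2P _ _.
rewrite /char; case: eqP => [|_]; first by have := q_odd; move=> /[swap] ->.
by rewrite PoszM legM.
Qed.

Let char_congr q a a' : q \in s -> (a = a' %[mod (if q == 2 then 8 else q)])%N ->
  char q a = char q a'.
Proof.
move=> /s_prime[->|[q_pr q_odd _]] /=.
  by rewrite /char /= (dyadic_per c2P a) (dyadic_per c2P a') => ->.
rewrite /char; case: eqP => [e|_ aa']; first by move: q_odd; rewrite e.
apply: leg_mod => //; rewrite -eqz_mod_dvd; apply/eqP.
by rewrite !modz_nat aa'.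
Qed.

Let char_modulus q : q \in s -> ((if q == 2 then 8 else q) %| 8 * m)%N.
Proof.
move=> /s_prime[->|[q_pr q_odd qm]]; first exact: dvdn_mulr.
by case: ifP => _; [exact: dvdn_mulr|exact: dvdn_mull].
Qed.

Let char_sqr q a : q \in s -> coprime a (8 * m) -> char q a ^+ 2 = 1.
Proof.
rewrite coprimeMr (@coprime_pexpr 3 a 2) // coprimen2 => + /andP[a_odd cam].
move=> /s_prime[->|[q_pr q_odd qm]]; first exact: dyadic_sqr c2P _ a_odd.
rewrite /char; case: eqP => [e|_]; first by move: q_odd; rewrite e.
rewrite leg_sqr1 // dvdzE /= -prime_coprime // coprime_sym.
exact: coprime_dvdr qm cam.
Qed.

Let char_sign q a : q \in s -> [\/ char q a = 0, char q a = 1 | char q a = -1].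
Proof.
move=> /s_prime[->|[q_pr q_odd qm]]; first exact: dyadic_sign c2P a.
rewrite /char; case: eqP => [e|_]; first by move: q_odd; rewrite e.
by rewrite /leg /qchar; case: ifP => _; [constructor 1|case: ifP => _; [constructor 2|constructor 3]].
Qed.

Let char1 q : q \in s -> char q 1 = 1.
Proof.
move=> /s_prime[->|[q_pr q_odd qm]]; first exact: dyadic1 c2P.
by rewrite /char; case: eqP => _; [exact: dyadic1 c2P|exact: leg1].
Qed.

(** By the Chinese remainder theorem, one character can be made -1 while all
    the others are 1; hence the characters are independent. *)
Let char_indep q : q \in s -> exists2 a, coprime a (8 * m) &
  char q a = -1 /\ forall q', q' \in s -> q' != q -> char q' a = 1.
Proof.
move=> qs.
pose d := (if q == 2 then 8 else q)%N; pose e := (8 * m %/ d)%N.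
have dM : (d %| 8 * m)%N := char_modulus qs.
have de : (8 * m = d * e)%N by rewrite /e [RHS]mulnC divnK.
have cde : coprime d e.
  case: (s_prime qs) => [q2|[q_pr q_odd qm]].
    by rewrite /e /d q2 /= mulKn // (@coprime_pexpl 3 2 m) // coprime2n.
  have -> : d = q by rewrite /d; case: eqP => // e2; move: q_odd; rewrite e2.
  have c8 : coprime q 8 by rewrite (@coprime_pexpr 3 q 2) // coprimen2.
  rewrite prime_coprime //; apply/negP => qe.
  have : (q ^ 2 %| 8 * m)%N.
    by rewrite de -mulnn dvdn_mul // /d; case: eqP => // e2; move: q_odd; rewrite e2.
  rewrite Gauss_dvdr; last by rewrite coprime_pexpl.
  by rewrite pfactor_dvdn // ltnNge sfm.
have [g cg qg] : exists2 g, coprime g d & char q g = -1.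
  case: (s_prime qs) => [q2|[q_pr q_odd qm]].
    have [g g_odd cg] := dyadic_neg c2P; exists g.
      by rewrite /d q2 (@coprime_pexpr 3 g 2) // coprimen2.
    by rewrite /char q2.
  have neq2 : (q == 2) = false by apply/eqP => e2; move: q_odd; rewrite e2.
  have [x x0 qx] := qchar_nonresidue q_pr q_odd.
  exists (val x); last first.
    by rewrite /char neq2 /leg -pmulrn [X in qchar X](natr_Zp x).
  rewrite /d neq2 coprime_sym prime_coprime //.
  apply: contra x0 => qx0; rewrite -(natr_Zp x) -(dvdn_pcharf (pchar_Fp q_pr)).
  exact: qx0.
have ad : (chinese d e g 1 = g %[mod d])%N := chinese_modl cde g 1.
have ae : (chinese d e g 1 = 1 %[mod e])%N := chinese_modr cde g 1.
exists (chinese d e g 1).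
  by rewrite de coprimeMr -coprime_modl ad coprime_modl cg -coprime_modl ae coprime_modl coprime1n.
split; first by rewrite (char_congr qs ad).
move=> q' q's neq; rewrite -(char1 q's); apply: char_congr => //.
have d'e : ((if q' == 2 then 8 else q') %| e)%N.
  have := char_modulus q's; rewrite de Gauss_dvdr //.
  have c8 r : odd r -> coprime r 8 by move=> r_odd; rewrite (@coprime_pexpr 3 r 2) // coprimen2.
  rewrite /d; case: (s_prime q's) neq => [->|[q'_pr q'_odd _]];
    case: (s_prime qs) => [->|[q_pr q_odd _]] //= neq.
  - by rewrite eq_sym (negPf neq) coprime_sym c8.
  - by rewrite (negPf neq) c8.
  case: eqP => [e2|_]; first by move: q'_odd; rewrite e2.
  case: eqP => [e2|_]; first by move: q_odd; rewrite e2.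
  by rewrite prime_coprime // dvdn_prime2.
by rewrite -(modn_dvdm _ d'e) ae modn_dvdm.
Qed.

(** If divsum chi N is nonzero, the primes with chi p = -1 have even exponents in
    N, so they disappear from its squarefree part, while dividing by a square
    leaves the characters unchanged. *)
Lemma genus_exists : exists N, [/\ (0 < N)%N, sqfree N, coprime N (8 * m),
  forall q, q \in s -> char q N = eps q &
  forall p, prime p -> (p %| N)%N -> \prod_(q <- s) char q p = 1].
Proof.
pose psi (i : 'I_(size s)) := char (nth 0%N s i).
have nth_s (i : 'I_(size s)) : nth 0%N s i \in s by rewrite mem_nth.
have prod_psi (F : nat -> int) : \prod_(q <- s) F q = \prod_(i < size s) F (nth 0%N s i).
  by rewrite (big_nth 0%N) big_mkord.
have M1 : (1 < 8 * m)%N by have := m0; lia.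
have [||||||||||N [N0 NM Npsi Nchi]] := @genus_divisor_sum 'I_(size s) (8 * m) n psi
    (fun i => eps (nth 0%N s i)) _ M1 n0.
- by rewrite card_ord; case: (s) s_neq0.
- by move=> i a a'; exact: charM.
- by move=> i; exact: char1.
- by move=> i a; apply: char_congr => //; rewrite -(modn_dvdm _ (char_modulus (nth_s i))) modnDr modn_dvdm ?char_modulus.
- by move=> i a; exact: char_sign.
- by move=> i a; exact: char_sqr.
- move=> A /set0Pn[i iA]; have [a ca [qa other]] := char_indep (nth_s i).
  exists a => //; rewrite (bigD1 i) //= /psi qa big1 ?mulr1 // => j /andP[_ ji].
  by apply: other => //; rewrite nth_uniq.
- by move=> i; exact: eps_sqr.
- by rewrite -(prod_psi eps).
- by move=> p u v p_pr pM pv pN; rewrite -(prod_psi (fun q => char q p)); apply: split pN.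
have [N1 [k [NE N10 k0 lN1]]] := sqfree_decomp N0.
have [cN1 ck] : coprime N1 (8 * m) /\ coprime k (8 * m).
  by move: NM; rewrite NE coprimeMl coprime_pexpl // => /andP[].
exists N1; split=> //.
- by move=> p _; rewrite lN1; case: odd.
- move=> q qs; have iq : (index q s < size s)%N by rewrite index_mem.
  have := Npsi (Ordinal iq); rewrite /psi /= nth_index // NE => <-.
  by rewrite -mulnn !charM // -expr2 char_sqr // mulr1.
move=> p p_pr pN1.
have cp : coprime p (8 * m) := coprime_dvdl pN1 cN1.
have : \prod_(q <- s) char q p ^+ 2 == 1.
  by rewrite big_seq big1 // => q qs; exact: char_sqr.
rewrite prodrXl sqrf_eq1 => /orP[/eqP//|/eqP chip].
have lo : odd (logn p N).
  have : (0 < logn p N1)%N by rewrite logn_gt0 mem_primes p_pr N10.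
  by rewrite lN1; case: odd.
suff : ~~ odd (logn p N) by rewrite lo.
apply: (@divsum_neq0 (fun a => \prod_i psi i a)) => //.
- by rewrite big1 // => i _; exact: char1.
- by move=> a a'; rewrite -big_split; apply: eq_bigr => i _; exact: charM.
- by rewrite -(prod_psi (fun q => char q p)).
Qed.
End GenusOfSquarefree.

(** * The three-square theorem *)

Lemma sqmod2 (a : int) : sqmod 2 a.
Proof.
exists a; apply/dvdzP; have [k [ak|ak]] : exists k, a = 2 * k \/ a = 2 * k + 1.
  by exists (a %/ 2)%Z; lia.
  by exists (k * (a - 1)); rewrite ak; ring.
by exists (k * a); rewrite ak; ring.
Qed.

Section GenusToSquares.
Variables (m n c : nat) (b : bool) (c2 : nat -> int) (e2 : int).
Hypotheses (m_odd : odd m) (sfm : sqfree m) (c2P : dyadic c2) (e2_sqr : e2 ^+ 2 = 1).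
Hypothesis n_c : [\/ n = m /\ c = 1%N, n = m /\ c = 2%N | n = (2 * m)%N /\ c = 1%N].
Hypothesis chi_leg : forall p, prime p -> odd p -> ~~ (p %| m)%N ->
  (if b then c2 p else 1) * leg p (chi4 m * m%:Z) = leg p (- n%:Z).
Hypothesis eps_one : (if b then e2 else 1) * \prod_(q <- primes m) leg q (- c%:Z) = 1.
Hypothesis nontrivial : b || (1 < m)%N.

Let prod_genus (F : nat -> int) : \prod_(q <- genus_primes m b) F q =
  (if b then F 2%N else 1) * \prod_(q <- primes m) F q.
Proof. by rewrite /genus_primes; case: b; rewrite ?big_cons ?mul1r. Qed.

Let odd_ne2 q : q \in primes m -> (q == 2)%N = false.
Proof. by move=> /(primes_odd m_odd); case: eqP => // ->. Qed.

Let c_odd q : odd q -> coprime q c.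
Proof. by move=> q_odd; case: n_c => -[_ ->]; rewrite ?coprimen1 ?coprimen2. Qed.

(** The number c N, with N from the genus given by eps, meets the conditions of
    three_squares_of_residues: - c N is a square modulo the primes q of m because
    (N/q) = eps q = (-c/q), and - n is a square modulo the primes p of N because
    (-n/p), the product of all genus characters, is 1 there. *)
Lemma three_squares_genus : exists u v w : int, n%:Z = u ^+ 2 + v ^+ 2 + w ^+ 2.
Proof.
have m0 : (0 < m)%N by case: m m_odd.
have n0 : (0 < n)%N by case: n_c => -[-> _]; lia.
pose eps q := if q == 2%N then e2 else leg q (- c%:Z).
have leg_c q : prime q -> odd q -> leg q (- c%:Z) ^+ 2 = 1.
  move=> q_pr q_odd; rewrite leg_sqr1 // dvdzE abszN /= -prime_coprime //.
  exact: c_odd.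
have chi_split p u v : prime p -> ~~ (p %| 8 * m)%N -> ~~ (p %| v)%N ->
    (p %| u ^ 2 + n * v ^ 2)%N -> leg p (- n%:Z) = 1.
  move=> p_pr p8m pv pN.
  have [p_odd pm] : odd p /\ ~~ (p %| m)%N.
    split; last by apply: contra p8m => /dvdn_mull; exact.
    by case: (even_prime p_pr) => // p2; move: p8m; rewrite p2 (dvdn_mulr m (isT : (2 %| 8)%N)).
  have pn : ~~ (p %| n)%N.
    case: n_c => -[-> _] //; rewrite Euclid_dvdM // (negPf pm) orbF.
    by rewrite dvdn_prime2 //; apply: contraL p_odd => /eqP->.
  have pu : ~~ (p %| u)%N.
    apply: contra pv => pu; move: pN; rewrite dvdn_addr; last first.
      by apply: dvdn_trans pu _; rewrite -mulnn dvdn_mulr.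
    by rewrite Euclid_dvdM // (negPf pn) /= Euclid_dvdX // andbT.
  transitivity (leg p (- n%:Z * v%:Z ^+ 2)).
    by rewrite legM // leg_square ?mulr1.
  rewrite -(leg_square p_pr p_odd (_ : ~~ (p %| u%:Z)%Z)) //.
  apply/esym/leg_mod => //.
  have -> : u%:Z ^+ 2 - - n%:Z * v%:Z ^+ 2 = (u ^ 2 + n * v ^ 2)%N%:Z by lia.
  exact: pN.
have prod_char p : prime p -> ~~ (p %| 8 * m)%N ->
    \prod_(q <- genus_primes m b) genus_char c2 q p = leg p (- n%:Z).
  move=> p_pr p8m.
  have pm : ~~ (p %| m)%N by apply: contra p8m => /dvdn_mull; exact.
  have p_odd : odd p.
    by case: (even_prime p_pr) => // p2; move: p8m; rewrite p2 (dvdn_mulr m (isT : (2 %| 8)%N)).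
  rewrite -chi_leg // -prod_leg_flip // prod_genus /genus_char /=; congr (_ * _).
  by rewrite big_seq [RHS]big_seq; apply: eq_bigr => q /odd_ne2->.
have [||||N [N0 sfN cN charN splitN]] := @genus_exists m n b c2 eps m_odd sfm n0 c2P.
- rewrite /genus_primes; case: (b) nontrivial => //= m1.
  apply/eqP => pm; have : pdiv m \in primes m.
    by rewrite mem_primes pdiv_prime // m0 pdiv_dvd.
  by rewrite pm.
- move=> q; rewrite /eps; case: ifP => // q2.
  have : q \in genus_primes m b -> q \in primes m.
    by rewrite /genus_primes; case: b => //; rewrite inE q2.
  move=> /[apply] qm; have q_odd := primes_odd m_odd qm; move: qm.
  by rewrite mem_primes => /and3P[q_pr _ _]; exact: leg_c.
- rewrite prod_genus /eps /= -[RHS]eps_one; congr (_ * _).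
  by rewrite big_seq [RHS]big_seq; apply: eq_bigr => q /odd_ne2->.
- by move=> p u v p_pr p8m pv pN; rewrite prod_char //; apply: chi_split pN.
have cNm : coprime N m by apply: coprime_dvdr cN; exact: dvdn_mull.
have N_odd : odd N.
  by have := coprime_dvdr (dvdn_mulr m (isT : (2 %| 8)%N)) cN; rewrite coprimen2; exact.
have c0 : (0 < c)%N by case: n_c => -[_ ->].
have [s sE] : sqmod n (- (c * N)%N%:Z).
  apply: sqmod_sqfree => // [p p_pr|q q_pr qn].
    case: n_c => -[-> _]; try exact: sfm.
    rewrite lognM //; case: (even_prime p_pr) => [->|p_odd].
      by rewrite (logn_coprime (_ : coprime 2 m)) ?coprime2n.
    by rewrite (logn_coprime (_ : coprime p 2)) ?coprimen2 ?sfm.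
  case: (even_prime q_pr) => [->|q_odd].
    exact: sqmod2.
  apply: leg1_square; rewrite // PoszM -mulNr legM //.
  have qm : q \in primes m.
    rewrite mem_primes q_pr m0; case: n_c qn => -[-> _] //.
    by rewrite Euclid_dvdM // dvdn_prime2 // => /orP[/eqP e|//]; move: q_odd; rewrite e.
  have q2 := odd_ne2 qm.
  have qs : q \in genus_primes m b by rewrite /genus_primes; case: b; rewrite ?inE ?qm ?orbT.
  by have := charN q qs; rewrite /genus_char /eps q2 => ->; rewrite -expr2 leg_c.
have [beta betaE] : sqmod (c * N) (- n%:Z).
  apply: sqmod_sqfree => [||p p_pr pcN]; first by rewrite muln_gt0 c0.
    move=> p p_pr; rewrite lognM //; case: (even_prime p_pr) => [->|p_odd].
      rewrite (logn_coprime (_ : coprime 2 N)) ?coprime2n // addn0.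
      by case: n_c => -[_ ->].
    by rewrite logn_coprime ?c_odd // sfN.
  case: (even_prime p_pr) => [->|p_odd].
    exact: sqmod2.
  have pN : (p %| N)%N by move: pcN; rewrite Gauss_dvdr // c_odd.
  apply: leg1_square => //; rewrite -prod_char //; first exact: splitN.
  rewrite -prime_coprime // coprime_sym; apply: coprime_dvdr pN _.
  by rewrite coprime_sym.
move: sE betaE; rewrite !opprK => sE betaE.
have ccN : coprime (c * N) n.
  rewrite coprimeMl.
  case: n_c => -[-> cE]; rewrite cE ?coprime1n ?coprime2n //= ?m_odd ?coprimeMr ?cNm //.
  by rewrite coprimen2 N_odd.
by apply: (@three_squares_of_residues n (c * N)%N beta s) => //; rewrite ltz_nat muln_gt0 c0.
Qed.
End GenusToSquares.

Lemma prod_leg_minus1 (m : nat) : odd m -> sqfree m ->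
  \prod_(q <- primes m) leg q (-1) = chi4 m.
Proof.
move=> m_odd sfm; have m0 : (0 < m)%N by case: m m_odd {sfm}.
rewrite -{2}(sqfree_primes m0 sfm) -(mult_prod_seq _ (erefl : chi4 1 = 1) chi4M).
rewrite big_seq [RHS]big_seq; apply: eq_bigr => q qm.
have q_odd := primes_odd m_odd qm; move: qm; rewrite mem_primes => /and3P[q_pr _ _].
exact: leg_minus1.
Qed.

Lemma prod_leg_two (m : nat) : odd m -> sqfree m ->
  \prod_(q <- primes m) leg q 2 = chi8 m.
Proof.
move=> m_odd sfm; have m0 : (0 < m)%N by case: m m_odd {sfm}.
rewrite -{2}(sqfree_primes m0 sfm) -(mult_prod_seq _ (erefl : chi8 1 = 1) chi8M).
rewrite big_seq [RHS]big_seq; apply: eq_bigr => q qm.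
have q_odd := primes_odd m_odd qm; move: qm; rewrite mem_primes => /and3P[q_pr _ _].
exact: leg_two.
Qed.

(** The dyadic character is determined by the condition that the genus characters
    multiply to p |-> (-n/p). The required signs must multiply to 1. For n = 3
    mod 8, when there is no dyadic character, this forces c = 2; for n = 7 mod 8
    it would be impossible. *)
Lemma three_squares_sqfree (n : nat) : (0 < n)%N -> sqfree n -> (n %% 8 != 7)%N ->
  exists u v w : int, n%:Z = u ^+ 2 + v ^+ 2 + w ^+ 2.
Proof.
move=> n0 sfn n7; have [n_odd|n_even] := boolP (odd n).
  have [n1|n1] := boolP (n %% 4 == 1)%N.
    have c4 : chi4 n = 1 by rewrite /chi4 n_odd n1.
    apply: (@three_squares_genus n n 1 true chi4 1) => //; first exact: dyadic_chi4.
    - by constructor 1.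
    - by move=> p p_pr p_odd pn; rewrite c4 mul1r -leg_minus1 // -legM // mulN1r.
    - by rewrite mul1r prod_leg_minus1.
  have n3 : (n %% 8 == 3)%N by lia.
  have c4 : chi4 n = -1 by rewrite /chi4 n_odd (negPf n1).
  apply: (@three_squares_genus n n 2 false chi4 1) => //; first exact: dyadic_chi4.
  - by constructor 2.
  - by move=> p p_pr p_odd pn; rewrite c4 mul1r mulN1r.
  - rewrite mul1r.
    transitivity (\prod_(q <- primes n) (leg q (-1) * leg q 2)).
      rewrite big_seq [RHS]big_seq; apply: eq_bigr => q qm.
      have q_odd := primes_odd n_odd qm; move: qm; rewrite mem_primes => /and3P[q_pr _ _].
      by rewrite -legM // mulN1r.
    rewrite big_split /= prod_leg_minus1 // prod_leg_two // c4 /chi8 n_odd (eqP n3).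
    by [].
  - lia.
pose m := n./2; have nE : n = (2 * m)%N by rewrite /m; lia.
have m_odd : odd m.
  apply/negPn/negP => m_even; have := sfn 2%N isT.
  have -> : n = (2 ^ 2 * m./2)%N by rewrite nE; lia.
  have m20 : (0 < m./2)%N by lia.
  by rewrite lognM // pfactorK //; lia.
have sfm : sqfree m.
  by move=> p p_pr; apply: leq_trans (sfn p p_pr); rewrite dvdn_leq_log // nE dvdn_mull.
have [m1|m1] := boolP (m %% 4 == 1)%N.
  have c4 : chi4 m = 1 by rewrite /chi4 m_odd m1.
  apply: (@three_squares_genus m n 1 true (fun a => chi4 a * chi8 a) 1) => //.
  - exact: dyadic_chi4_chi8.
  - by constructor 3.
  - move=> p p_pr p_odd pn; rewrite c4 mul1r -leg_minus1 // -leg_two // -!legM //.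
    by congr (leg _ _); rewrite nE PoszM; ring.
  - by rewrite mul1r prod_leg_minus1.
have c4 : chi4 m = -1 by rewrite /chi4 m_odd (negPf m1).
apply: (@three_squares_genus m n 1 true chi8 (-1)) => //; first exact: dyadic_chi8.
- by constructor 3.
- move=> p p_pr p_odd pn; rewrite c4 -leg_two // -!legM //.
  by congr (leg _ _); rewrite nE PoszM; ring.
- by rewrite prod_leg_minus1 // c4.
Qed.

(** An odd square is 1 modulo 8, so the squarefree part of n has the same residue
    as n. *)
Theorem three_squares (n : nat) : (n %% 4 != 0)%N -> (n %% 8 != 7)%N ->
  exists a b c : nat, n = (a ^ 2 + b ^ 2 + c ^ 2)%N.
Proof.
move=> n4 n7; have n0 : (0 < n)%N by lia.
have [N [k [NE N0 k0 lN]]] := sqfree_decomp n0.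
have k_odd : odd k.
  apply: contraR n4 => k_even; rewrite NE -[k](odd_double_half) (negPf k_even) add0n.
  by rewrite -muln2 expnMn mulnA modnMl.
have k8 : (k ^ 2 %% 8 = 1)%N.
  rewrite -modnXm; have : odd (k %% 8) by lia.
  have : (k %% 8 < 8)%N by rewrite ltn_mod.
  by case: (k %% 8)%N => [|[|[|[|[|[|[|[|]]]]]]]].
have N7 : (N %% 8 != 7)%N by move: n7; rewrite NE -modnMmr k8 muln1.
have [|u [v [w uvw]]] := three_squares_sqfree N0 _ N7.
  by move=> p _; rewrite lN; case: odd.
exists (k * `|u|)%N, (k * `|v|)%N, (k * `|w|)%N.
have absE (x : int) : ((`|x| ^ 2)%N%:Z = x ^+ 2)%R.
  by rewrite -mulnn PoszM -expr2 abszE real_normK ?num_real.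
have NE' : N = (`|u| ^ 2 + `|v| ^ 2 + `|w| ^ 2)%N.
  by apply/eqP; rewrite -eqz_nat !PoszD !absE uvw.
by rewrite NE NE'; ring.
Qed.

Import ListNotations.
Local Close Scope ring_scope.
Local Open Scope Z_scope.

(** * Division of quaternions of norm divisible by 11 or 14 *)

Definition signed_perms (A B C : Z) : list (Z * Z * Z) :=
  List.flat_map (fun v => let '(x, y, z) := v in
    [(x, y, z); (x, y, -z); (x, -y, z); (x, -y, -z);
     (-x, y, z); (-x, y, -z); (-x, -y, z); (-x, -y, -z)])
  [(A, B, C); (A, C, B); (B, A, C); (B, C, A); (C, A, B); (C, B, A)].

(** Divisibility by d of the product of s + A i + B j + C k with the conjugate of
    p i + q j + r k. If d is the norm of p i + q j + r k, this is divisibility by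
    that quaternion. *)
Definition divisible (d p q r s : Z) (v : Z * Z * Z) : bool :=
  let '(A, B, C) := v in
  ((p * A + q * B + r * C) mod d =? 0) && ((s * p - (q * C - r * B)) mod d =? 0) &&
  ((s * q - (r * A - p * C)) mod d =? 0) && ((s * r - (p * B - q * A)) mod d =? 0).

Definition residues (d : Z) : list Z := List.map Z.of_nat (List.seq 0 (Z.to_nat d)).

(** A quaternion of norm divisible by d has a divisor of norm d. For d = 11 and
    d = 14, the four-square representations of d are the signed permutations of
    (0, 1, 1, 3) and (0, 1, 2, 3), so up to units that divisor is a signed
    permutation of i + j + 3 k or i + 2 j + 3 k. Divisibility depends on the
    residues modulo d only, so the claim is a finite one. *)
Definition divisible_table (d p q r : Z) : bool :=
  List.forallb (fun s => List.forallb (fun A => List.forallb (fun B => List.forallb (fun C =>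
    if (s * s + A * A + B * B + C * C) mod d =? 0
    then List.existsb (divisible d p q r s) (signed_perms A B C) else true)
  (residues d)) (residues d)) (residues d)) (residues d).

Lemma table11 : divisible_table 11 1 1 3 = true.
Proof. vm_compute. reflexivity. Qed.

Lemma table14 : divisible_table 14 1 2 3 = true.
Proof. vm_compute. reflexivity. Qed.

Definition congr_mod (d x y : Z) : Prop := exists k, x = y + k * d.
Definition congr_mod3 (d : Z) (v w : Z * Z * Z) : Prop :=
  congr_mod d v.1.1 w.1.1 /\ congr_mod d v.1.2 w.1.2 /\ congr_mod d v.2 w.2.

Lemma congr_mod_opp d x y : congr_mod d x y -> congr_mod d (- x) (- y).
Proof. intros [k ->]; exists (- k); ring. Qed.

Lemma signed_perms_congr d A B C A' B' C' :
  congr_mod d A A' -> congr_mod d B B' -> congr_mod d C C' ->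
  Forall2 (congr_mod3 d) (signed_perms A B C) (signed_perms A' B' C').
Proof.
intros hA hB hC.
repeat (apply Forall2_cons || apply Forall2_nil);
  repeat split; simpl; try apply congr_mod_opp; assumption.
Qed.

Lemma signed_perms_norm A B C A' B' C' : In (A', B', C') (signed_perms A B C) ->
  A' * A' + B' * B' + C' * C' = A * A + B * B + C * C.
Proof.
intros h; simpl in h.
repeat (destruct h as [h|h]; [injection h; intros; subst; ring|]); contradiction.
Qed.

Lemma divisible_congr d p q r s s' v w : d <> 0 -> congr_mod d s s' -> congr_mod3 d v w ->
  divisible d p q r s v = divisible d p q r s' w.
Proof.
destruct v as [[A B] C], w as [[A' B'] C']; unfold congr_mod3; simpl.
intros d0 [k ->] [[a ->] [[b ->] [c ->]]].
replace (p * (A' + a * d) + q * (B' + b * d) + r * (C' + c * d))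
  with (p * A' + q * B' + r * C' + (p * a + q * b + r * c) * d) by ring.
replace ((s' + k * d) * p - (q * (C' + c * d) - r * (B' + b * d)))
  with (s' * p - (q * C' - r * B') + (k * p - (q * c - r * b)) * d) by ring.
replace ((s' + k * d) * q - (r * (A' + a * d) - p * (C' + c * d)))
  with (s' * q - (r * A' - p * C') + (k * q - (r * a - p * c)) * d) by ring.
replace ((s' + k * d) * r - (p * (B' + b * d) - q * (A' + a * d)))
  with (s' * r - (p * B' - q * A') + (k * r - (p * b - q * a)) * d) by ring.
now rewrite !Z_mod_plus_full.
Qed.

Lemma in_residues d x : 0 < d -> In (x mod d) (residues d).
Proof.
intros d0; apply in_map_iff; exists (Z.to_nat (x mod d)).
pose proof (Z.mod_pos_bound x d d0); split; [lia|].
apply in_seq; lia.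
Qed.

Lemma congr_mod_mod d x : 0 < d -> congr_mod d x (x mod d).
Proof. intros d0; exists (x / d); pose proof (Z_div_mod_eq_full x d); lia. Qed.

Lemma divisible_exists d p q r s A B C : 0 < d -> divisible_table d p q r = true ->
  (s * s + A * A + B * B + C * C) mod d = 0 ->
  exists A' B' C', A' * A' + B' * B' + C' * C' = A * A + B * B + C * C /\
    divisible d p q r s (A', B', C') = true.
Proof.
intros d0 tab h.
unfold divisible_table in tab; rewrite forallb_forall in tab.
pose proof (tab _ (in_residues s d0)) as t1; clear tab; rewrite forallb_forall in t1.
pose proof (t1 _ (in_residues A d0)) as t2; clear t1; rewrite forallb_forall in t2.
pose proof (t2 _ (in_residues B d0)) as t3; clear t2; rewrite forallb_forall in t3.
pose proof (t3 _ (in_residues C d0)) as t4; clear t3.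
destruct (congr_mod_mod s d0) as [k hk], (congr_mod_mod A d0) as [a ha],
  (congr_mod_mod B d0) as [b hb], (congr_mod_mod C d0) as [c hc].
set s' := s mod d in t4 hk; set A' := A mod d in t4 ha.
set B' := B mod d in t4 hb; set C' := C mod d in t4 hc.
clearbody s' A' B' C'.
assert (e : (s' * s' + A' * A' + B' * B' + C' * C') mod d = 0).
  rewrite <- h, hk, ha, hb, hc.
  rewrite -[LHS](Z_mod_plus_full _ (2 * s' * k + k * k * d + 2 * A' * a + a * a * d
     + 2 * B' * b + b * b * d + 2 * C' * c + c * c * d)).
  f_equal; ring.
rewrite e in t4.
rewrite Z.eqb_refl in t4; apply existsb_exists in t4; destruct t4 as [v [vin hv]].
assert (F : Forall2 (congr_mod3 d) (signed_perms A B C) (signed_perms A' B' C')).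
  by apply signed_perms_congr; eexists; eassumption.
assert (G : forall l l', Forall2 (congr_mod3 d) l l' -> In v l' ->
   exists w, In w l /\ congr_mod3 d w v).
  induction 1 as [|x y l l' xy ll' IH]; simpl; first by [].
  intros [->|vl']; first by exists x; auto.
  by destruct (IH vl') as [w [wl wv]]; exists w; auto.
destruct (G _ _ F vin) as [[[A1 B1] C1] [win wv]].
exists A1, B1, C1; split; first by apply signed_perms_norm.
by rewrite (@divisible_congr d p q r s s' _ v) //; [lia|exists k].
Qed.

(** The quotient x i + y j + z k + w has norm m, and the product with
    p i + q j + r k has the scalar part p x + q y + r z up to sign. *)
Lemma quaternion_quotient d p q r s m A B C :
  0 < d -> p * p + q * q + r * r = d -> divisible_table d p q r = true ->
  s * s + A * A + B * B + C * C = d * m ->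
  exists x y z w, p * x + q * y + r * z = s /\ x * x + y * y + z * z + w * w = m.
Proof.
intros d0 dE tab h.
destruct (@divisible_exists d p q r s A B C d0 tab) as [A' [B' [C' [norm div]]]].
  by rewrite h Z.mul_comm Z_mod_mult.
rewrite /divisible !Bool.andb_true_iff !Z.eqb_eq in div.
destruct div as [[[h0 h1] h2] h3].
apply Z_div_exact_full_2 in h0, h1, h2, h3; try lia.
set w := (_ / d) in h0; set x := (_ / d) in h1.
set y := (_ / d) in h2; set z := (_ / d) in h3.
clearbody x y z w.
exists x, y, z, w; split.
  apply (Z.mul_reg_l _ _ d); first lia.
  transitivity (p * (d * x) + q * (d * y) + r * (d * z)); first by ring.
  rewrite -h1 -h2 -h3 -dE; ring.
apply (Z.mul_reg_l _ _ (d * d)); first nia.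
transitivity ((d * x) * (d * x) + (d * y) * (d * y) + (d * z) * (d * z) + (d * w) * (d * w)).
  by ring.
rewrite -h0 -h1 -h2 -h3.
transitivity (d * (d * m)); last by ring.
rewrite -h -!Z.add_assoc [A * A + _]Z.add_assoc -norm -dE; ring.
Qed.

(** * Making the coordinates nonnegative by rational reflections *)

Definition thirds_repr (m : Z) : Prop := exists a b c w t,
  [/\ 0 <= a, 0 <= b, 0 <= c & 0 <= w] /\
  a * a + b * b + c * c + 9 * (w * w) = 9 * m /\ a + b + 3 * c = 3 * (t * t).

Definition fifths_repr (m : Z) : Prop := exists a b c e t,
  [/\ 0 <= a, 0 <= b, 0 <= c & 0 <= e] /\
  a * a + b * b + c * c + e * e = 25 * m /\ a + 2 * b + 3 * c = 5 * (t * t).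

Definition sum3sq (n : Z) : Prop := exists A B C, n = A * A + B * B + C * C.

Lemma sqr_lt_sqr x y : 0 <= x -> x < y -> x * x < y * y.
Proof. nia. Qed.

(** Cauchy's inequality turns a large value s of the given linear form into
    upper bounds for all shorter linear forms. *)
Lemma short_form_bound lo m s x y z w c p q r k : 0 <= s -> 0 < c ->
  x * x + y * y + z * z + w * w = m -> lo * m <= s * s ->
  p * p + q * q + r * r + k * k <= lo * (c * c) ->
  p * x + q * y + r * z + k * w <= c * s.
Proof.
intros s0 c0 nrm big short.
destruct (Z_le_gt_dec (p * x + q * y + r * z + k * w) (c * s)) as [|gt]; first by [].
exfalso; set T := p * x + q * y + r * z + k * w in gt.
assert (h : (c * s) * (c * s) < T * T) by (apply: sqr_lt_sqr; lia).
assert (cs : T * T <= (p * p + q * q + r * r + k * k) * m).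
  pose proof (Z.square_nonneg (p * y - q * x)); pose proof (Z.square_nonneg (p * z - r * x)).
  pose proof (Z.square_nonneg (p * w - k * x)); pose proof (Z.square_nonneg (q * z - r * y)).
  pose proof (Z.square_nonneg (q * w - k * y)); pose proof (Z.square_nonneg (r * w - k * z)).
  rewrite /T -nrm; lia.
assert (m0 : 0 <= m) by nia.
assert (h1 : (p * p + q * q + r * r + k * k) * m <= lo * (c * c) * m).
  by apply: Z.mul_le_mono_nonneg_r.
assert (h2 : c * c * (lo * m) <= c * c * (s * s)) by (apply: Z.mul_le_mono_nonneg_l; nia).
lia.
Qed.

(** When x < 0, the reflection in the vector (2, 1, -1) of norm 6 is applied. It
    preserves x + y + 3 z, and it maps the integer points to points with
    denominator 3. Each coordinate of the image is nonnegative because the opposite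
    would bound t^2 by a linear form whose squared length is at most 8. *)
Lemma reflection_thirds m x y z w t : x + y + 3 * z = t * t ->
  x * x + y * y + z * z + w * w = m -> 8 * m <= t * t * (t * t) -> x <= y ->
  thirds_repr m.
Proof.
intros lin nrm big xy.
assert (s0 : 0 <= t * t) by nia.
assert (bound := fun c p q r k c0 => @short_form_bound 8 m (t * t) x y z w c p q r k s0 c0 nrm big).
have z0 : 0 <= z by have := bound 1 1 1 0 0; lia.
destruct (Z_le_gt_dec 0 x) as [x0|x0].
  exists (3 * x), (3 * y), (3 * z), (Z.abs w), t; split; [split|split]; lia.
exists (- x - 2 * y + 2 * z), (- 2 * x + 2 * y + z), (2 * x + y + 2 * z), (Z.abs w), t.
split; [split|split]; try lia.
- by have := bound 1 0 2 2 0; lia.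
- by have := bound 1 (-1) 0 1 0; lia.
Qed.

(** Three isometries with denominator 5 that preserve x + 2 y + 3 z are used.
    If only x is negative, the reflection in (3, 0, -1) is applied. If y is
    negative, one of two isometries that move the fourth coordinate as well, the
    sign of its first image coordinate deciding which. *)
Lemma reflection_fifths m x y z w t : x + 2 * y + 3 * z = t * t ->
  x * x + y * y + z * z + w * w = m -> 8 * m <= t * t * (t * t) -> 0 <= w ->
  fifths_repr m.
Proof.
intros lin nrm big w0.
assert (s0 : 0 <= t * t) by nia.
assert (bound := fun c p q r k c0 => @short_form_bound 8 m (t * t) x y z w c p q r k s0 c0 nrm big).
have z0 : 0 <= z by have := bound 1 1 2 0 0; lia.
destruct (Z_le_gt_dec 0 y) as [y0|y0].
  destruct (Z_le_gt_dec 0 x) as [x0|x0].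
    exists (5 * x), (5 * y), (5 * z), (5 * w), t; split; [split|split]; lia.
  exists (- 4 * x + 3 * z), (5 * y), (3 * x + 4 * z), (5 * w), t.
  split; [split|split]; try lia.
  by have := bound 5 (-4) 10 3 0; lia.
destruct (Z_le_gt_dec 0 (- 2 * x + 2 * y + z + 4 * w)) as [a0|a0].
  exists (- 2 * x + 2 * y + z + 4 * w), (2 * x - 2 * y + 4 * z + w),
    (x + 4 * y + 2 * z - 2 * w), (Z.abs (4 * x + y - 2 * z + 2 * w)), t.
  split; [split|split]; try lia.
  - by have := bound 1 0 0 1 0; lia.
  - by have := bound 5 2 (-2) 9 6; lia.
exists (4 * x + 2 * y - z + 2 * w), (2 * x + y + 2 * z - 4 * w),
  (- x + 2 * y + 4 * z + 2 * w), (Z.abs (2 * x - 4 * y + 2 * z + w)), t.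
split; [split|split]; try lia.
(* Otherwise x + 2 y + 3 z would be less than (16 x - 10 y + 53 z) / 20, a form of
   squared length 3165 / 400 < 8. *)
- by have := bound 20 16 (-10) 53 0; lia.
- by have := bound 2 2 (-1) 1 0; lia.
- by have := bound 5 8 4 3 (-6); lia.
Qed.

Lemma thirds_of_sum3sq m t : 8 * m <= t * t * (t * t) ->
  sum3sq (11 * m - t * t * (t * t)) -> thirds_repr m.
Proof.
intros big [A [B [C e]]].
destruct (@quaternion_quotient 11 1 1 3 (t * t) m A B C) as [x [y [z [w [lin nrm]]]]];
  [by []|by []|exact table11|lia|].
destruct (Z_le_gt_dec x y).
  by apply: (@reflection_thirds m x y z w t); lia.
by apply: (@reflection_thirds m y x z w t); lia.
Qed.

Lemma fifths_of_sum3sq m t : 8 * m <= t * t * (t * t) ->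
  sum3sq (14 * m - t * t * (t * t)) -> fifths_repr m.
Proof.
intros big [A [B [C e]]].
destruct (@quaternion_quotient 14 1 2 3 (t * t) m A B C) as [x [y [z [w [lin nrm]]]]];
  [by []|by []|exact table14|lia|].
by apply: (@reflection_fifths m x y z (Z.abs w) t); lia.
Qed.

Lemma sum3sq_mul4 n : sum3sq n -> sum3sq (4 * n).
Proof. intros [A [B [C ->]]]; exists (2 * A), (2 * B), (2 * C); ring. Qed.

Lemma sum3sq_mod n : 0 < n -> n mod 4 <> 0 -> n mod 8 <> 7 -> sum3sq n.
Proof.
intros n0 n4 n7; destruct (Z_of_nat_complete n) as [k kn]; first lia.
pose proof (Z_div_mod_eq_full n 4); pose proof (Z.mod_pos_bound n 4 (erefl _)).
pose proof (Z_div_mod_eq_full n 8); pose proof (Z.mod_pos_bound n 8 (erefl _)).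
have k4 : (k %% 4 != 0)%N by lia.
have k7 : (k %% 8 != 7)%N by lia.
have [a [b [c e]]] := three_squares k4 k7.
by exists (Z.of_nat a), (Z.of_nat b), (Z.of_nat c); lia.
Qed.

(** * Finite verification *)

Fixpoint sum3sq_test (fuel : nat) (n : Z) : bool :=
  if n <=? 0 then n =? 0 else
  if fuel is S fuel' then
    if n mod 4 =? 0 then sum3sq_test fuel' (n / 4) else negb (n mod 8 =? 7)
  else false.

Lemma sum3sq_testP fuel n : sum3sq_test fuel n = true -> sum3sq n.
Proof.
revert n; induction fuel as [|fuel IH]; intros n; simpl;
  destruct (Z.leb_spec n 0); try (intros h; assert (n = 0) as -> by lia; by exists 0, 0, 0); try easy.
destruct (Z.eqb_spec (n mod 4) 0) as [n4|n4].
  intros h; replace n with (4 * (n / 4)) by (pose proof (Z_div_mod_eq_full n 4); lia).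
  by apply sum3sq_mul4, IH.
by intros h; apply sum3sq_mod => // n7; rewrite n7 in h.
Qed.

(** Under call by value, unlike with a disjunction, the conditional stops at the
    first success. *)
Fixpoint has_witness (T : Type) (f : T -> bool) (l : list T) : bool :=
  if l is x :: l' then if f x then true else has_witness f l' else false.

Lemma has_witnessP (T : Type) (f : T -> bool) (l : list T) :
  has_witness f l = true -> exists x, In x l /\ f x = true.
Proof.
elim: l => //= x l IH; case e: (f x); first by exists x; split; [left|].
by move=> /IH [y [yl fy]]; exists y; split; [right|].
Qed.

Definition interval (a : Z) (len : Z) : list Z :=
  List.map (fun i => a + Z.of_nat i) (List.seq 0 (Z.to_nat len)).

(** Squares are 0, 1, 4 or 9 modulo 16; the test saves most square roots. *)
Definition is_square (n : Z) : bool :=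
  if Z.land n 15 is (0 | 1 | 4 | 9) then Z.sqrt n * Z.sqrt n =? n else false.

(** Looks for y and z near the foot of the perpendicular from the origin to the
    plane x + q y + r z = t^2, within the ball of squared radius m. *)
Definition search_at (q r m t : Z) : bool :=
  let k := 1 + q * q in let d := k + r * r in let s := t * t in
  let h := Z.sqrt ((d * m - s * s) / d) in
  has_witness (fun z =>
    let u := s - r * z in let disc := k * (m - z * z) - u * u in
    if (0 <=? z) && (0 <=? disc) then
      let g := Z.sqrt disc / k in
      has_witness (fun y =>
        let x := u - q * y in let n := m - x * x - y * y - z * z in
        if (0 <=? x) && (0 <=? y) && (0 <=? n) then is_square n else false)
      (interval (q * u / k - g) (2 * g + 2))
    else false)
  (interval (r * s / d - h) (2 * h + 2)).

Fixpoint search (q r m : Z) (fuel : nat) (t : Z) : bool :=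
  if fuel is S fuel' then
    if (if sum3sq_test 12 ((1 + q * q + r * r) * m - t * t * (t * t))
        then search_at q r m t else false) then true
    else search q r m fuel' (t - 1)
  else false.

Lemma searchP q r m fuel t : search q r m fuel t = true ->
  exists x y z w t, [/\ 0 <= x, 0 <= y, 0 <= z & 0 <= w] /\
    x * x + y * y + z * z + w * w = m /\ x + q * y + r * z = t * t.
Proof.
revert t; induction fuel as [|fuel IH]; intros t; [by []|cbn [search]].
case: (sum3sq_test _ _); last exact: IH.
case e: (search_at q r m t); last (exact: IH); intros _.
rewrite /search_at in e; apply has_witnessP in e; destruct e as [z [_ e]].
destruct (Z.leb_spec 0 z) as [z0|]; last by [].
set u := t * t - r * z in e.
move: e; rewrite andTb; case: (0 <=? _); last by []; move=> e.
apply has_witnessP in e; destruct e as [y [_ e]].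
set x := u - q * y in e.
set n := m - x * x - y * y - z * z in e.
destruct (Z.leb_spec 0 x) as [x0|]; last by [].
destruct (Z.leb_spec 0 y) as [y0|]; last by [].
destruct (Z.leb_spec 0 n) as [n0|]; last by [].
have /Z.eqb_eq sq : (Z.sqrt n * Z.sqrt n =? n) = true.
  by move: e; rewrite /= /is_square; case: (Z.land n 15) => [|p|p] //; repeat case: p => [p|p|] //.
exists x, y, z, (Z.sqrt n), t; split.
  split=> //; exact: Z.sqrt_nonneg.
split; [rewrite sq /n; ring|rewrite /x /u; ring].
Qed.

Fixpoint all_from (f : Z -> bool) (n : nat) (a : Z) : bool :=
  if n is S n' then if f a then all_from f n' (a + 1) else false else true.

Lemma all_fromP f n a : all_from f n a = true ->
  forall b, a <= b < a + Z.of_nat n -> f b = true.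
Proof.
elim: n a => [|n IH] a; first by lia.
rewrite /=; case fa: (f a) => // /IH h b hb.
destruct (Z.eq_dec a b) as [<-|ab]; first by [].
by apply: h; lia.
Qed.

Section Coverage.
Variables (q r lo step : Z) (T0 : nat) (known : list Z) (cls : Z -> Z -> bool).
Variable P : Z -> Prop.
Let d := 1 + q * q + r * r.
Let pow4 t := t * t * (t * t).

Definition covered (m t : Z) : bool :=
  if (lo * m <=? pow4 t) && (pow4 t <=? d * m) then sum3sq_test 12 (d * m - pow4 t) else false.

(** Values of t outside the class often work as well; they are tried before the
    search. *)
Definition verified (m t : Z) : bool :=
  if cls m t then
    if covered m (t - 1) then true else
    if covered m (t - 2) then true else
    if covered m (t - 3) then true else
    if has_witness (Z.eqb m) known then true else
    search q r m 60 (Z.sqrt (Z.sqrt (d * m)))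
  else true.

Definition verified_gap (t : Z) : bool :=
  let a := if t <? step then 1 else pow4 (t - step) / lo + 1 in
  all_from (fun m => verified m t) (Z.to_nat (pow4 t / d + 1 - a)) a.

Definition verified_gaps : bool := all_from verified_gap T0 0.

Hypotheses (step0 : 0 < step) (lo0 : 0 < lo) (d0 : 0 < d).
Hypothesis P_sum3sq : forall m t, lo * m <= pow4 t -> sum3sq (d * m - pow4 t) -> P m.
Hypothesis P_known : forall m, In m known -> P m.
Hypothesis P_search : forall m x y z w t, [/\ 0 <= x, 0 <= y, 0 <= z & 0 <= w] ->
  x * x + y * y + z * z + w * w = m -> x + q * y + r * z = t * t -> P m.
Hypothesis cls_sum3sq : forall m t, cls m t = true -> 0 < d * m - pow4 t -> sum3sq (d * m - pow4 t).
Hypothesis cls_step : forall m t, cls m (t - step) = cls m t.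
Hypothesis step_T0 : step <= Z.of_nat T0.
Hypothesis large : forall t, Z.of_nat T0 <= t -> lo * pow4 t <= d * pow4 (t - step).
Hypothesis gaps : verified_gaps = true.

Let le_pow4 u : 0 <= u -> u <= pow4 u.
Proof.
move=> u0; have h : u <= u * u by nia.
by apply: (Z.le_trans _ (u * u)) => //; rewrite /pow4; nia.
Qed.

Let covered_P m t : covered m t = true -> P m.
Proof.
rewrite /covered; destruct (Z.leb_spec (lo * m) (pow4 t)) as [h|]; last by [].
rewrite andTb; case: (pow4 t <=? d * m); last by [].
by move=> /sum3sq_testP; apply: P_sum3sq.
Qed.

Let verified_P m t : cls m t = true -> verified m t = true -> P m.
Proof.
rewrite /verified => ->.
case c1: (covered m (t - 1)); first by move=> _; apply: covered_P c1.
case c2: (covered m (t - 2)); first by move=> _; apply: covered_P c2.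
case c3: (covered m (t - 3)); first by move=> _; apply: covered_P c3.
case k: (has_witness _ _).
  by move=> _; apply: P_known; have [x [xk /Z.eqb_eq ->]] := has_witnessP k.
by move=> /searchP [x [y [z [w [t' [pos [nrm lin]]]]]]]; apply: P_search pos nrm lin.
Qed.

(** The least t in the residue class of m with lo m <= t^4 either satisfies
    t^4 <= d m, or is so small that m lies in one of finitely many gaps between
    (t - step)^4 / lo and t^4 / d; these are searched one number at a time. *)
Lemma coverage m t0 : 0 < m -> 0 <= t0 -> cls m t0 = true -> P m.
Proof.
move=> m0 t00 ct0.
have exQ : exists t : nat, (lo * m <=? pow4 (Z.of_nat t)) && cls m (Z.of_nat t).
  exists (Z.to_nat (t0 + step * (lo * m))); rewrite Z2Nat.id; last by nia.
  apply/andP; split.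
    apply/Z.leb_le; have : lo * m <= t0 + step * (lo * m) by nia.
    by move/Z.le_trans; apply; apply: le_pow4; nia.
  rewrite -[lo * m]Z2Nat.id; last by nia.
  elim: (Z.to_nat _) => [|k IH]; first by rewrite Z.mul_0_r Z.add_0_r.
  rewrite -cls_step; move: IH; congr (is_true (cls m _)); lia.
case: (ex_minnP exQ) => T /andP[/Z.leb_le loT cT] minT.
set t := Z.of_nat T in loT cT.
have pow4_ge0 : 0 <= pow4 t by rewrite /pow4; nia.
have prev : t < step \/ pow4 (t - step) < lo * m.
  destruct (Z_lt_le_dec t step) as [|st]; first by left.
  right; apply/Z.nle_gt => h.
  have := minT (Z.to_nat (t - step)); rewrite Z2Nat.id; last lia.
  rewrite cls_step cT andbT => /(_ (proj2 (Z.leb_le _ _) h)); rewrite /t in st *; lia.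
destruct (Z_lt_le_dec 0 (d * m - pow4 t)) as [pos|neg].
  by apply: (@P_sum3sq m t) => //; apply: cls_sum3sq.
destruct (Z.eq_dec (d * m - pow4 t) 0) as [zero|nonzero].
  by apply: (@P_sum3sq m t) => //; rewrite zero; exists 0, 0, 0.
have small : t < Z.of_nat T0.
  apply/Z.nle_gt => T0t; have h := large T0t; case: prev => [|h2]; first by lia.
  have h3 : d * pow4 (t - step) < d * (lo * m) by apply: Zmult_lt_compat_l.
  have h4 : lo * (d * m) <= lo * pow4 t.
    by apply: Z.mul_le_mono_nonneg_l; [exact: Z.lt_le_incl|apply/Z.le_sub_0; exact: neg].
  lia.
apply: (verified_P cT).
have range_t : 0 <= t < 0 + Z.of_nat T0 by split; [exact: Zle_0_nat|exact: small].
have := all_fromP gaps range_t.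
rewrite /verified_gap => /all_fromP; apply.
have hi : m <= pow4 t / d.
  by apply: Z.div_le_lower_bound => //; apply/Z.le_sub_0; exact: neg.
split; last by lia.
destruct (Z.ltb_spec t step) as [|st]; first by lia.
case: prev => [|h]; first by lia.
by have := Z.div_lt_upper_bound (pow4 (t - step)) lo m lo0 h; lia.
Qed.
End Coverage.

(** The classes below consist of values of t for which 11 m - t^4, respectively
    14 m - t^4, is a sum of three squares as soon as it is positive. In the second
    case the odd multiples m of 8 need a condition on t modulo 4. *)
Definition thirds_parity (c : Z) : Z := if c mod 8 is (4 | 5) then 1 else 0.
Definition fifths_parity (c : Z) : Z := if c mod 4 =? 2 then 1 else 0.
Definition thirds_class (m t : Z) : bool :=
  if m mod 16 =? 0 then false
  else t mod 2 =? thirds_parity m.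
Definition fifths_class (m t : Z) : bool :=
  if m mod 8 =? 0 then false else t mod 2 =? fifths_parity m.
Definition fifths_class8 (m t : Z) : bool :=
  if m mod 16 =? 8 then t mod 4 =? (if (m / 8) mod 8 =? 1 then 2 else 0) else false.

(** From t = 27 on, 8 t^4 <= 11 (t - 2)^4. The numbers 7, 15 and 133 have
   representations with denominator 3 only. *)
Lemma thirds_gaps : verified_gaps 1 3 8 2 27 [7; 15; 133] thirds_class = true.
Proof. vm_compute. reflexivity. Qed.

(** From t = 16 on, 8 t^4 <= 14 (t - 2)^4, and from t = 31 on,
   8 t^4 <= 14 (t - 4)^4. The numbers 12, 72, 76 and 92 have representations with
   denominator 5 only. *)
Lemma fifths_gaps : verified_gaps 2 3 8 2 16 [12; 76; 92] fifths_class = true.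
Proof. vm_compute. reflexivity. Qed.

Lemma fifths_gaps8 : verified_gaps 2 3 8 4 31 [72] fifths_class8 = true.
Proof. vm_compute. reflexivity. Qed.

Lemma sum3sq_mod8 n k e : 0 < n -> n = e + k * 8 ->
  negb (e mod 4 =? 0) && negb (e mod 8 =? 7) = true -> sum3sq n.
Proof.
rewrite Bool.andb_true_iff !Bool.negb_true_iff !Z.eqb_neq => n0 nE [e4 e8].
apply: sum3sq_mod => //; last by rewrite nE Z_mod_plus_full.
by rewrite nE; replace (k * 8) with (2 * k * 4) by ring; rewrite Z_mod_plus_full.
Qed.

Lemma sum3sq_2mod4 n k : 0 < n -> n = 2 + k * 4 -> sum3sq n.
Proof.
move=> n0 nE; apply: sum3sq_mod => //; first by rewrite nE Z_mod_plus_full.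
pose proof (Z_div_mod_eq_full n 8); lia.
Qed.

Lemma pow4_parity t : exists j, t * t * (t * t) = 16 * j + t mod 2.
Proof.
destruct (Z.Even_or_Odd t) as [[k ->]|[k ->]].
  by exists (k * k * (k * k)); rewrite (Z.mul_comm 2 k) Z_mod_mult; ring.
have -> : (2 * k + 1) mod 2 = 1.
  by replace (2 * k + 1) with (1 + k * 2) by ring; rewrite Z_mod_plus_full.
have [i hi] : exists i, k * k + k = 2 * i.
  destruct (Z.Even_or_Odd k) as [[l ->]|[l ->]].
    by exists (l * (2 * l + 1)); ring.
  by exists ((2 * l + 1) * (l + 1)); ring.
exists (k * k * (k * k) + 2 * (k * k * k) + k * k + i).
transitivity (16 * (k * k * (k * k) + 2 * (k * k * k) + k * k) + 8 * (k * k + k) + 1); first by ring.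
rewrite hi; ring.
Qed.

Lemma mod16_decomp m : exists a c, [/\ m = 16 * a + c, 0 <= c < 16, m mod 16 = c,
  m mod 8 = c mod 8 & m mod 4 = c mod 4].
Proof.
pose proof (Z_div_mod_eq_full m 16); pose proof (Z.mod_pos_bound m 16 (erefl _)).
set a := m / 16 in H; set c := m mod 16 in H H0 *; exists a, c; split => //.
  by rewrite H -(Z_mod_plus_full c (2 * a) 8); f_equal; ring.
by rewrite H -(Z_mod_plus_full c (4 * a) 4); f_equal; ring.
Qed.

Lemma residue_table (f : Z -> bool) d c : 0 <= c < d -> forallb f (residues d) = true -> f c = true.
Proof.
move=> hc; rewrite forallb_forall; apply; rewrite -(Z.mod_small c d hc).
apply: in_residues; lia.
Qed.

Lemma thirds_class_sum3sq m t : thirds_class m t = true -> 0 < 11 * m - t * t * (t * t) ->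
  sum3sq (11 * m - t * t * (t * t)).
Proof.
have [a [c [mE hc m16 m8 _]]] := mod16_decomp m; have [j ->] := pow4_parity t.
rewrite /thirds_class; have -> : thirds_parity m = thirds_parity c by rewrite /thirds_parity m8.
rewrite m16.
destruct (Z.eqb_spec c 0) as [|c0]; first by [].
move=> /Z.eqb_eq ->; rewrite mE => pos.
destruct (Z.eq_dec c 8) as [c8|c8].
  rewrite c8 in pos *; change (thirds_parity 8) with 0 in pos |- *.
  have -> : 11 * (16 * a + 8) - (16 * j + 0) = 4 * (2 + (11 * a - j + 5) * 4) by ring.
  by apply/sum3sq_mul4/(@sum3sq_2mod4 _ (11 * a - j + 5)) => //; lia.
apply: (@sum3sq_mod8 _ (2 * (11 * a - j)) (11 * c - thirds_parity c)) => //; first by ring.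
have := @residue_table (fun c => if (c =? 0) || (c =? 8) then true else
  negb ((11 * c - thirds_parity c) mod 4 =? 0) && negb ((11 * c - thirds_parity c) mod 8 =? 7))
  16 c hc (erefl _).
by rewrite (proj2 (Z.eqb_neq c 0) c0) (proj2 (Z.eqb_neq c 8) c8).
Qed.

Lemma fifths_class_sum3sq m t : fifths_class m t = true -> 0 < 14 * m - t * t * (t * t) ->
  sum3sq (14 * m - t * t * (t * t)).
Proof.
have [a [c [mE hc m16 m8 m4]]] := mod16_decomp m; have [j ->] := pow4_parity t.
rewrite /fifths_class m8; have -> : fifths_parity m = fifths_parity c by rewrite /fifths_parity m4.
destruct (Z.eqb_spec (c mod 8) 0) as [|c0]; first by [].
move=> /Z.eqb_eq ->; rewrite mE => pos.
destruct (Z.eqb_spec (c mod 4) 0) as [c4|c4].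
  have := @residue_table (fun c => if c mod 4 =? 0 then
    if c mod 8 =? 0 then true else c =? 8 * (c / 8) + 4 else true) 16 c hc (erefl _).
  rewrite c4 (proj2 (Z.eqb_neq _ 0) c0) => /Z.eqb_eq; set g := c / 8 => cE.
  have fp : fifths_parity c = 0 by rewrite /fifths_parity c4.
  rewrite fp in pos *.
  have e : 14 * (16 * a + c) - (16 * j + 0) = 4 * (2 + (14 * a + 7 * g + 3 - j) * 4).
    by rewrite cE; ring.
  rewrite e in pos *; apply/sum3sq_mul4/(@sum3sq_2mod4 _ (14 * a + 7 * g + 3 - j)) => //.
  lia.
apply: (@sum3sq_mod8 _ (2 * (14 * a - j)) (14 * c - fifths_parity c)) => //; first by ring.
have := @residue_table (fun c => if (c mod 4 =? 0) then true else
  negb ((14 * c - fifths_parity c) mod 4 =? 0) && negb ((14 * c - fifths_parity c) mod 8 =? 7))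
  16 c hc (erefl _).
by rewrite (proj2 (Z.eqb_neq _ 0) c4).
Qed.

Lemma fifths_class8_sum3sq m t : fifths_class8 m t = true -> 0 < 14 * m - t * t * (t * t) ->
  sum3sq (14 * m - t * t * (t * t)).
Proof.
rewrite /fifths_class8; destruct (Z.eqb_spec (m mod 16) 8) as [m8|]; last by [].
pose proof (Z_div_mod_eq_full m 16); set a := m / 16 in H; rewrite m8 in H.
have -> : m / 8 = 2 * a + 1 by apply/esym/Z.div_unique_exact; lia.
pose proof (Z_div_mod_eq_full a 4); pose proof (Z.mod_pos_bound a 4 (erefl _)).
set e := a / 4 in H0; set f := a mod 4 in H0 H1; clearbody e f.
have -> : (2 * a + 1) mod 8 = 2 * f + 1.
  by apply/esym/(Z.mod_unique_pos _ _ e); lia.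
pose proof (Z_div_mod_eq_full t 4); set k := t / 4 in H2; clearbody k.
destruct (Z.eqb_spec (2 * f + 1) 1) as [f1|f1] => /Z.eqb_eq tE pos;
  rewrite tE in H2; clearbody a.
  have [j hj] := pow4_parity (2 * k + 1).
  have o : (2 * k + 1) mod 2 = 1.
    by replace (2 * k + 1) with (1 + k * 2) by ring; rewrite Z_mod_plus_full.
  have E : 14 * m - t * t * (t * t) = 4 * (4 * (6 + (7 * e - 2 * j) * 8)).
    transitivity (14 * m - 16 * ((2 * k + 1) * (2 * k + 1) * ((2 * k + 1) * (2 * k + 1)))).
      by rewrite H2; ring.
    rewrite hj o H H0; have -> : f = 0 by lia.
    ring.
  by rewrite E; apply/sum3sq_mul4/sum3sq_mul4/(@sum3sq_mod8 _ (7 * e - 2 * j) 6) => //; lia.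
have E : 14 * m - t * t * (t * t) = 4 * (4 * (14 * f + 7 + (7 * e - 2 * (k * k * (k * k))) * 8)).
  by rewrite H2 H H0; ring.
rewrite E; apply/sum3sq_mul4/sum3sq_mul4.
apply: (@sum3sq_mod8 _ (7 * e - 2 * (k * k * (k * k))) (14 * f + 7)) => //; first by lia.
have : f = 1 \/ f = 2 \/ f = 3 by lia.
by case=> [->|[->|->]].
Qed.

Lemma mod_sub_self t d : (t - d) mod d = t mod d.
Proof. by rewrite -(Z_mod_plus_full (t - d) 1 d); f_equal; ring. Qed.

Lemma pow4_ratio lo d step T0 : (forall k, 0 <= k ->
    lo * ((T0 + k) * (T0 + k) * ((T0 + k) * (T0 + k))) <=
    d * ((T0 + k - step) * (T0 + k - step) * ((T0 + k - step) * (T0 + k - step)))) ->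
  forall t, T0 <= t -> lo * (t * t * (t * t)) <= d * ((t - step) * (t - step) * ((t - step) * (t - step))).
Proof.
by move=> h t ht; have := h (t - T0); replace (T0 + (t - T0)) with t by ring; apply; lia.
Qed.

Lemma thirds_not16 m : m mod 16 <> 0 -> 0 < m -> thirds_repr m.
Proof.
move=> m16 m0; pose t0 := thirds_parity m.
have [pos ct0] : 0 <= t0 /\ thirds_class m t0 = true.
  have : t0 = 0 \/ t0 = 1.
    rewrite /t0 /thirds_parity; case: (m mod 8) => [|p|p]; auto.
    by do 3?[case: p => [p|p|]; auto].
  by rewrite /thirds_class (proj2 (Z.eqb_neq _ _) m16) -/t0; case=> ->.
apply: (@coverage 1 3 8 2 27 [7; 15; 133] thirds_class thirds_repr _ _ _ _ _ _ _ _ _ _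
  thirds_gaps m t0 m0 pos ct0) => //.
- by move=> n t; apply: thirds_of_sum3sq.
- move=> n; simpl; case=> [<-|[<-|[<-|[]]]].
  + by exists 2, 7, 1, 1, 2.
  + by exists 2, 7, 1, 3, 2.
  + by exists 10, 14, 1, 10, 3.
- move=> n x y z w t [x0 y0 z0 w0] nrm lin.
  exists (3 * x), (3 * y), (3 * z), w, t; split; [split|split]; lia.
- exact: thirds_class_sum3sq.
- by move=> n t; rewrite /thirds_class mod_sub_self.
apply: pow4_ratio => k k0.
have k2 : 0 <= k * k by nia.
have k3 : 0 <= k * k * k by nia.
have k4 : 0 <= k * k * k * k by nia.
lia.
Qed.

Lemma fifths_not16 m : m mod 16 <> 0 -> 0 < m -> fifths_repr m.
Proof.
move=> m16 m0.
have psearch n x y z w t : [/\ 0 <= x, 0 <= y, 0 <= z & 0 <= w] ->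
    x * x + y * y + z * z + w * w = n -> x + 2 * y + 3 * z = t * t -> fifths_repr n.
  move=> [x0 y0 z0 w0] nrm lin.
  by exists (5 * x), (5 * y), (5 * z), (5 * w), t; split; [split|split]; lia.
destruct (Z.eq_dec (m mod 16) 8) as [m8|m8].
  pose t0 := if (m / 8) mod 8 =? 1 then 2 else 0.
  have pos : 0 <= t0 by rewrite /t0; case: (_ =? 1).
  have ct0 : fifths_class8 m t0 = true.
    by rewrite /fifths_class8 m8 /t0; case: (_ =? 1).
  apply: (@coverage 2 3 8 4 31 [72] fifths_class8 fifths_repr _ _ _ _ _ _ _ _ _ _
    fifths_gaps8 m t0 m0 pos ct0) => //.
  - by move=> n t; apply: fifths_of_sum3sq.
  - by move=> n; simpl; case=> [<-|[]]; exists 14, 0, 2, 40, 2.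
  - exact: fifths_class8_sum3sq.
  - by move=> n t; rewrite /fifths_class8 mod_sub_self.
  apply: pow4_ratio => k k0.
  have k2 : 0 <= k * k by nia.
  have k3 : 0 <= k * k * k by nia.
  have k4 : 0 <= k * k * k * k by nia.
  lia.
have m8' : m mod 8 <> 0.
  have [a [c [_ hc mc -> _]]] := mod16_decomp m; rewrite mc in m16 m8 => c8.
  by pose proof (Z_div_mod_eq_full c 8); lia.
pose t0 := fifths_parity m.
have pos : 0 <= t0 by rewrite /t0 /fifths_parity; case: (_ =? 2).
have ct0 : fifths_class m t0 = true.
  by rewrite /fifths_class (proj2 (Z.eqb_neq _ _) m8') /t0 /fifths_parity; case: (_ =? 2).
apply: (@coverage 2 3 8 2 16 [12; 76; 92] fifths_class fifths_repr _ _ _ _ _ _ _ _ _ _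
  fifths_gaps m t0 m0 pos ct0) => //.
- by move=> n t; apply: fifths_of_sum3sq.
- move=> n; simpl; case=> [<-|[<-|[<-|[]]]].
  + by exists 11, 3, 1, 13, 2.
  + by exists 7, 35, 1, 25, 4.
  + by exists 9, 1, 3, 47, 2.
- exact: fifths_class_sum3sq.
- by move=> n t; rewrite /fifths_class mod_sub_self.
apply: pow4_ratio => k k0.
have k2 : 0 <= k * k by nia.
have k3 : 0 <= k * k * k by nia.
have k4 : 0 <= k * k * k * k by nia.
lia.
Qed.

(** Multiplying x, y, z, w by 4 multiplies m by 16 and replaces t by 2 t. *)
Lemma reduce_16 (Q : Z -> Prop) : Q 0 -> (forall m, Q m -> Q (16 * m)) ->
  (forall m, m mod 16 <> 0 -> 0 < m -> Q m) -> forall m, 0 <= m -> Q m.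
Proof.
move=> Q0 Q16 Qm m m0; pattern m; apply: Zlt_0_ind m m0 => m IH m0.
destruct (Z.eq_dec m 0) as [->|mn0]; first by [].
destruct (Z.eq_dec (m mod 16) 0) as [e|ne]; last by apply: Qm => //; lia.
pose proof (Z_div_mod_eq_full m 16) as h; rewrite e Z.add_0_r in h.
by rewrite h; apply/Q16/IH; lia.
Qed.

Theorem thirds m : 0 <= m -> thirds_repr m.
Proof.
apply: reduce_16 => [|{}m|{}m]; [by exists 0, 0, 0, 0, 0| |exact: thirds_not16].
move=> [a [b [c [w [t [[a0 b0 c0 w0] [nrm lin]]]]]]].
by exists (4 * a), (4 * b), (4 * c), (4 * w), (2 * t); split; [split|split]; lia.
Qed.

Theorem fifths m : 0 <= m -> fifths_repr m.
Proof.
apply: reduce_16 => [|{}m|{}m]; [by exists 0, 0, 0, 0, 0| |exact: fifths_not16].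
move=> [a [b [c [w [t [[a0 b0 c0 w0] [nrm lin]]]]]]].
by exists (4 * a), (4 * b), (4 * c), (4 * w), (2 * t); split; [split|split]; lia.
Qed.

Local Close Scope Z_scope.
Local Open Scope ring_scope.

(** * Rational representations *)

Lemma natfrac_div (q : nat) (k : nat) : natfrac q (k%:R / q%:R).
Proof. by exists k. Qed.

Lemma thirds_nat (m : nat) : exists a b c w t : nat,
  (a * a + b * b + c * c + 9 * (w * w) = 9 * m)%N /\ (a + b + 3 * c = 3 * (t * t))%N.
Proof.
have [a [b [c [w [t [[a0 b0 c0 w0] [nrm lin]]]]]]] := thirds (Zle_0_nat m).
have [a' ea] := Z_of_nat_complete a a0; have [b' eb] := Z_of_nat_complete b b0.
have [c' ec] := Z_of_nat_complete c c0; have [w' ew] := Z_of_nat_complete w w0.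
have [t' et] := Z_of_nat_complete (Z.abs t) (Z.abs_nonneg t).
rewrite -Z.abs_square et ea eb ec in lin; rewrite ea eb ec ew in nrm.
by exists a', b', c', w', t'; split; lia.
Qed.

Lemma fifths_nat (m : nat) : exists a b c e t : nat,
  (a * a + b * b + c * c + e * e = 25 * m)%N /\ (a + 2 * b + 3 * c = 5 * (t * t))%N.
Proof.
have [a [b [c [w [t [[a0 b0 c0 w0] [nrm lin]]]]]]] := fifths (Zle_0_nat m).
have [a' ea] := Z_of_nat_complete a a0; have [b' eb] := Z_of_nat_complete b b0.
have [c' ec] := Z_of_nat_complete c c0; have [w' ew] := Z_of_nat_complete w w0.
have [t' et] := Z_of_nat_complete (Z.abs t) (Z.abs_nonneg t).
rewrite -Z.abs_square et ea eb ec in lin; rewrite ea eb ec ew in nrm.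
by exists a', b', c', w', t'; split; lia.
Qed.

Lemma int_square_nat (t : nat) : int_square (t%:R * t%:R).
Proof. by exists t%:Z; rewrite rmorphXn. Qed.

Theorem theorem1p7 :
  (forall m : nat, exists x y z w : rat,
     [/\ natfrac 3 x /\ natfrac 3 y /\ natfrac 3 z,
         w \is a Num.nat,
         m%:R = x ^+ 2 + y ^+ 2 + z ^+ 2 + w ^+ 2
       & int_square (x + y + 3%:R * z)])
  /\
  (forall m : nat, exists x y z w : rat,
     [/\ natfrac 5 x /\ natfrac 5 y /\ natfrac 5 z,
         natfrac 5 w,
         m%:R = x ^+ 2 + y ^+ 2 + z ^+ 2 + w ^+ 2
       & int_square (x + 2%:R * y + 3%:R * z)]).
Proof.
split=> m.
  have [a [b [c [w [t [nrm lin]]]]]] := thirds_nat m.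
  exists (a%:R / 3%:R), (b%:R / 3%:R), (c%:R / 3%:R), w%:R; split.
  - by split; [|split]; exact: natfrac_div.
  - exact: natr_nat.
  - have {}nrm : a%:R * a%:R + b%:R * b%:R + c%:R * c%:R + 9%:R * (w%:R * w%:R) =
      9%:R * m%:R :> rat by rewrite -!natrM -!natrD nrm.
    have -> : (m%:R : rat) = 9%:R * m%:R / 9%:R by field.
    by rewrite -nrm; field.
  have {}lin : a%:R + b%:R + 3%:R * c%:R = 3%:R * (t%:R * t%:R) :> rat.
    by rewrite -!natrM -!natrD lin.
  have -> : (a%:R / 3%:R + b%:R / 3%:R + 3%:R * (c%:R / 3%:R) : rat) =
    (a%:R + b%:R + 3%:R * c%:R) / 3%:R by field.
  by rewrite lin mulrAC divff ?mul1r //; exact: int_square_nat.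
have [a [b [c [e [t [nrm lin]]]]]] := fifths_nat m.
exists (a%:R / 5%:R), (b%:R / 5%:R), (c%:R / 5%:R), (e%:R / 5%:R); split.
- by split; [|split]; exact: natfrac_div.
- exact: natfrac_div.
- have {}nrm : a%:R * a%:R + b%:R * b%:R + c%:R * c%:R + e%:R * e%:R =
    25%:R * m%:R :> rat by rewrite -!natrM -!natrD nrm.
  have -> : (m%:R : rat) = 25%:R * m%:R / 25%:R by field.
  by rewrite -nrm; field.
have {}lin : a%:R + 2%:R * b%:R + 3%:R * c%:R = 5%:R * (t%:R * t%:R) :> rat.
  by rewrite -!natrM -!natrD lin.
have -> : (a%:R / 5%:R + 2%:R * (b%:R / 5%:R) + 3%:R * (c%:R / 5%:R) : rat) =
  (a%:R + 2%:R * b%:R + 3%:R * c%:R) / 5%:R by field.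
by rewrite lin mulrAC divff ?mul1r //; exact: int_square_nat.
Qed.
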